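(* For every $n=1,2,3,\dots$: (1) The Steiner polynomial $S_{B^n}^{\mathbb{R}^n}$ is dissipative; moreover, all its roots are negative. (2) The Steiner polynomial $S_{B^n\times 0}^{\mathbb{R}^{n+1}}$ is of the form $S_{B^n\times 0}^{\mathbb{R}^{n+1}}(t)=t\cdot D_{B^n\times 0}^{\mathbb{R}^{n+1}}(t)$, where the polynomial $D_{B^n\times 0}^{\mathbb{R}^{n+1}}$ is dissipative. If $n$ is large enough, then the polynomial $S_{B^n\times 0}^{\mathbb{R}^{n+1}}$ has non-real roots. (3) The Steiner polynomial $S_{Q^n}^{\mathbb{R}^n}$ is dissipative; moreover, all its roots are negative. (4) The Steiner polynomial $S_{Q^n\times 0}^{\mathbb{R}^{n+1}}$ is of the form $S_{Q^n\times 0}^{\mathbb{R}^{n+1}}(t)=t\cdot D_{Q^n\times 0}^{\mathbb{R}^{n+1}}(t)$, where the polynomial $D_{Q^n\times 0}^{\mathbb{R}^{n+1}}$ is dissipative and all its roots are negative.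
   Context: $B^n=\{x\in\mathbb{R}^n:\sum_{k}|x_k|^2\le1\}$ is the unit ball and $Q^n=\{x\in\mathbb{R}^n:\max_k|x_k|\le1\}$ is the unit cube. For $V\subset\mathbb{R}^n$, the squeezed cylinder with base $V$ is $V\times0=\{(x,0):x\in V\}\subset\mathbb{R}^{n+1}$. For a compact convex set $V\subset\mathbb{R}^m$, the Steiner polynomial $S_V^{\mathbb{R}^m}$ is the polynomial satisfying $S_V^{\mathbb{R}^m}(t)=\mathrm{Vol}_m(V+tB^m)$ for all real $t\ge 0$; it is considered for complex $t$. A polynomial is dissipative if all its roots lie in the open left half plane $\{z:\mathrm{Re}\,z<0\}$. *)

(* Defs.v *)
From HB Require Import structures.
From mathcomp Require Import all_boot all_order all_algebra.
From mathcomp Require Import all_classical all_reals all_analysis.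
From mathcomp Require Import complex.

Set Implicit Arguments.
Unset Strict Implicit.
Unset Printing Implicit Defensive.
Import Order.TTheory GRing.Theory Num.Theory.
Local Open Scope classical_set_scope.
Local Open Scope ring_scope.

Section lebesgue_measure_tuple.
Context {R : realType}.
Local Notation RT := (measurableTypeR R).

Definition tuple_snoc n (p : n.-tuple RT * RT) : n.+1.-tuple RT :=
  [tuple of rcons p.1 p.2].

Definition tuple_unsnoc n (t : n.+1.-tuple RT) : n.-tuple RT * RT :=
  ([tuple tnth t (widen_ord (leqnSn n) i) | i < n], tnth t ord_max).

Lemma tnth_snoc_widen n (p : n.-tuple RT * RT) (i : 'I_n) :
  tnth (tuple_snoc p) (widen_ord (leqnSn n) i) = tnth p.1 i.
Proof. by rewrite !(tnth_nth 0) /= nth_rcons size_tuple ltn_ord. Qed.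

Lemma tnth_snoc_max n (p : n.-tuple RT * RT) :
  tnth (tuple_snoc p) ord_max = p.2.
Proof. by rewrite (tnth_nth 0) /= nth_rcons size_tuple ltnn eqxx. Qed.

Lemma widen_or_max n (i : 'I_n.+1) :
  (exists j, i = widen_ord (leqnSn n) j) \/ i = ord_max.
Proof.
have [lt_in|] := ltnP i n; first by left; exists (Ordinal lt_in); exact/val_inj.
by right; apply/val_inj/eqP => /=; rewrite eqn_leq -ltnS ltn_ord.
Qed.

Lemma tuple_snocK n : cancel (@tuple_snoc n) (@tuple_unsnoc n).
Proof.
move=> [t x]; rewrite /tuple_unsnoc tnth_snoc_max; congr pair.
by apply: eq_from_tnth => i; rewrite tnth_mktuple tnth_snoc_widen.
Qed.

Lemma measurable_tuple_snoc n : measurable_fun setT (@tuple_snoc n).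
Proof.
apply/measurable_fun_tnthP => i.
have [[j ->]|->] := widen_or_max i.
- rewrite (_ : _ \o _ = (@tnth n RT ^~ j) \o fst).
    exact: measurableT_comp (measurable_tnth _) measurable_fst.
  by apply/funext => p /=; rewrite tnth_snoc_widen.
- rewrite (_ : _ \o _ = snd); first exact: measurable_snd.
  by apply/funext => p /=; rewrite tnth_snoc_max.
Qed.

Lemma measurable_tuple_unsnoc n : measurable_fun setT (@tuple_unsnoc n).
Proof.
apply: measurable_fun_pair; last exact: measurable_tnth.
apply/measurable_fun_tnthP => i.
rewrite (_ : _ \o _ = (@tnth n.+1 RT ^~ (widen_ord (leqnSn n) i))).
  exact: measurable_tnth.
by apply/funext => t /=; rewrite tnth_mktuple.
Qed.

Section step.
Context (n : nat) (m : {sigma_finite_measure set (n.-tuple RT) -> \bar R}).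
Local Open Scope ereal_scope.

(* Product of m with the one-dimensional Lebesgue measure, moved from
   (n.-tuple R * R) to n.+1.-tuple R. *)
Definition snoc_measure : set (n.+1.-tuple RT) -> \bar R :=
  pushforward (m \x @lebesgue_measure R) (@tuple_snoc n).

Let mpre (A : set (n.+1.-tuple RT)) :
  measurable A -> measurable (@tuple_snoc n @^-1` A).
Proof.
by move=> mA; rewrite -[X in measurable X]setTI; exact: measurable_tuple_snoc.
Qed.

Let snoc0 : snoc_measure set0 = 0.
Proof. by rewrite /snoc_measure /pushforward preimage_set0 measure0. Qed.

Let snoc_ge0 A : 0 <= snoc_measure A.
Proof. by rewrite /snoc_measure /pushforward; apply: measure_ge0. Qed.

Let snoc_sigma_additive : semi_sigma_additive snoc_measure.
Proof.
move=> F mF tF mUF; rewrite /snoc_measure /pushforward preimage_bigcup.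
apply: measure_semi_sigma_additive.
- by move=> k; exact: mpre.
- apply/trivIsetP => /= i j _ _ ij; rewrite -preimage_setI.
  by move/trivIsetP : tF => /(_ _ _ _ _ ij) ->//; rewrite preimage_set0.
- by rewrite -preimage_bigcup; exact: mpre.
Qed.

HB.instance Definition _ := isMeasure.Build _ _ _
  snoc_measure snoc0 snoc_ge0 snoc_sigma_additive.

Let snoc_sigma_finite : sigma_finite setT snoc_measure.
Proof.
have /sigma_finiteP[F [UF ndF mF]] := sigma_finiteT m.
have /sigma_finiteP[G [UG ndG mG]] := sigma_finiteT (@lebesgue_measure R).
exists (fun k => @tuple_unsnoc n @^-1` (F k `*` G k)).
  apply/esym/seteqP; split=> // t _.
  have [i _ Fit] : (\bigcup_i F i) (tuple_unsnoc t).1 by rewrite -UF.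
  have [j _ Gjt] : (\bigcup_i G i) (tuple_unsnoc t).2 by rewrite -UG.
  exists (maxn i j) => //; split=> /=.
    by move: Fit; exact/subsetPset/ndF/leq_maxl.
  by move: Gjt; exact/subsetPset/ndG/leq_maxr.
move=> k; have [mFk Fkoo] := mF k; have [mGk Gkoo] := mG k; split.
  rewrite -[X in measurable X]setTI; apply: measurable_tuple_unsnoc => //.
  exact: measurableX.
rewrite /snoc_measure /pushforward -comp_preimage.
rewrite (_ : _ \o _ = id) ?preimage_id; last exact/funext/tuple_snocK.
by rewrite product_measure1E// lte_mul_pinfty// ge0_fin_numE.
Qed.

HB.instance Definition _ := Measure_isSigmaFinite.Build _ _ _
  snoc_measure snoc_sigma_finite.

End step.

(* Lebesgue measure on the Borel sets of R^n as the n-fold product of the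
   one-dimensional one; lebesgue_measure_tuple_box gives its value on boxes. *)
Fixpoint lebesgue_measure_tuple n :
    {sigma_finite_measure set (n.-tuple RT) -> \bar R} :=
  if n is k.+1 then snoc_measure (lebesgue_measure_tuple k)
  else @dirac _ (0.-tuple RT) [tuple] R.

Lemma lebesgue_measure_tuple_box n (A : 'I_n -> set RT) :
  (forall i, measurable (A i)) ->
  (lebesgue_measure_tuple n [set t | forall i, A i (tnth t i)]
   = \prod_(i < n) @lebesgue_measure R (A i))%E.
Proof.
elim: n A => [|n IHn] A mA /=.
  by rewrite big_ord0 diracE mem_set//= => -[].
rewrite /snoc_measure /pushforward big_ord_recr/= -IHn//.
have mbox : measurable [set t : n.-tuple RT |
    forall i, A (widen_ord (leqnSn n) i) (tnth t i)].
  rewrite (_ : mkset _ = \bigcap_(i in [set: 'I_n])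
    (@tnth n RT ^~ i @^-1` A (widen_ord (leqnSn n) i))).
    apply: fin_bigcap_measurable => // i _.
    by rewrite -[X in measurable X]setTI; exact: measurable_tnth.
  by apply/seteqP; split=> [t At i _|t At i]; exact: At.
rewrite -product_measure1E//; congr (_ _).
apply/seteqP; split=> [p Ap|p [Ap1 Ap2] i] /=.
  split=> [i|]; last by rewrite -tnth_snoc_max; exact: Ap.
  by rewrite -tnth_snoc_widen; exact: Ap.
have [[j ->]|->] := widen_or_max i.
  by rewrite tnth_snoc_widen; exact: Ap1.
by rewrite tnth_snoc_max.
Qed.

End lebesgue_measure_tuple.

Definition unit_ball (R : realType) (m : nat) : set 'rV[R]_m :=
  [set x | \sum_(k < m) `|x ord0 k| ^+ 2 <= 1].
Arguments unit_ball : clear implicits.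

Definition unit_cube (R : realType) (m : nat) : set 'rV[R]_m :=
  [set x | \big[Num.max/0]_(k < m) `|x ord0 k| <= 1].
Arguments unit_cube : clear implicits.

Section steiner.
Context {R : realType}.

(* Row vectors carry the vector space structure of R^m and tuples its product
   sigma-algebra; vol is Lebesgue measure read through x_i = tnth t i. *)
Definition vol m (A : set 'rV[R]_m) : \bar R :=
  lebesgue_measure_tuple m [set t | A (\row_i tnth t i)].

Definition squeezed_cylinder m (V : set 'rV[R]_m) : set 'rV[R]_(m + 1) :=
  [set row_mx x (0 : 'rV[R]_1) | x in V].

Definition dilation m (V : set 'rV[R]_m) (t : R) : set 'rV[R]_m :=
  [set x + t *: b | x in V & b in unit_ball R m].

Definition is_steiner_poly m (V : set 'rV[R]_m) (S : {poly R}) : Prop :=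
  forall t : R, 0 <= t -> vol (dilation V t) = (S.[t])%:E.

Lemma is_steiner_poly_unique m (V : set 'rV[R]_m) (S T : {poly R}) :
  is_steiner_poly V S -> is_steiner_poly V T -> S = T.
Proof.
move=> VS VT; apply/eqP; rewrite -subr_eq0; apply/negPn/negP => ST0.
pose s : seq R := [seq k%:R | k <- iota 0 (size (S - T))].
have us : uniq s.
  by rewrite map_inj_uniq ?iota_uniq// => a b /eqP; rewrite eqr_nat => /eqP.
have rs : all (root (S - T)) s.
  apply/allP => _ /mapP[k _ ->].
  have [Sk Tk] := (VS _ (ler0n R k), VT _ (ler0n R k)).
  by rewrite /root hornerD hornerN subr_eq0 -eqe -Sk -Tk.
by have := max_poly_roots ST0 rs us; rewrite size_map size_iota ltnn.
Qed.

(* The default 0 is used only when no Steiner polynomial exists, which by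
   Steiner's theorem does not happen for compact convex V; 0 itself is not
   dissipative. *)
Definition steiner_poly m (V : set 'rV[R]_m) : {poly R} :=
  xget 0 [set S | is_steiner_poly V S].

Definition complexify (p : {poly R}) : {poly R[i]} :=
  map_poly (real_complex R) p.

Definition dissipative (p : {poly R[i]}) : Prop :=
  forall z : R[i], root p z -> complex.Re z < 0.

(* In the partial order of R[i], z < 0 says that z is real and negative. *)
Definition negative_roots (p : {poly R[i]}) : Prop :=
  forall z : R[i], root p z -> z < 0.

End steiner.

(* Main.v *)
Require Import Defs.
From HB Require Import structures.
From mathcomp Require Import all_boot all_order all_algebra.
From mathcomp Require Import all_classical all_reals all_analysis.
From mathcomp Require Import measurable_realfun complex.
From mathcomp Require Import ring lra zify.
Set Implicit Arguments.
Unset Strict Implicit.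
Unset Printing Implicit Defensive.
Import Order.TTheory GRing.Theory Num.Theory.
Import numFieldNormedType.Exports.
Local Open Scope classical_set_scope.
Local Open Scope ring_scope.

(* Let c_k be the integral over [-1, 1] of (1 - u^2)^(k/2), and let T be the
   linear operator sending t^k to c_k t^(k+1). Each parallel body is described
   by the nearest point projection, and slicing it by hyperplanes orthogonal to
   the last axis gives its Steiner polynomial; with K_k = c_0 ... c_(k-1), the
   volume of the unit k-ball, the four polynomials are
     (1) K_n (1 + t)^n,
     (2) T applied to K_n (1 + t)^n,
     (3) (2 + T)^n applied to 1, that is sum_k C(n, k) 2^(n-k) K_k t^k,
     (4) T applied to (3).
   For (3) and (4), the recurrence c_(k+2) (k+3) = c_k (k+2) makes K_(k+s) the
   limit as N grows of a_N b_N^k (k + s + 2)(k + s + 4) ... (k + s + 2N) for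
   suitable a_N, b_N > 0. Multiplying coefficients by k + a
   with a > 0 is the operator p |-> a p + t p', which keeps all roots negative,
   and negative roots survive the limit.
   For (2), integrating (1 + t r)^n against r / sqrt(1 - r^2), an increasing
   weight, gives a positive real part after multiplication by t / (1 + t)^(n+1)
   when Re t >= 0. Non-real roots appear as soon as n >= 2, because
   c_1^2 < c_0 c_2 contradicts Newton's inequality. *)

(** * Coefficients of rescaled polynomials and of binomial powers *)

Lemma coef_comp_scale (R : comNzRingType) (p : {poly R}) x k :
  (p \Po (x *: 'X))`_k = p`_k * x ^+ k.
Proof.
rewrite coef_comp_poly.
under eq_bigr do rewrite exprZn coefZ coefXn mulrA.
have [kp|pk] := ltnP k (size p); last first.
  rewrite nth_default// mul0r big1// => i _.
  by rewrite gtn_eqF ?mulr0// (leq_trans _ pk).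
rewrite (bigD1 (Ordinal kp))//= eqxx mulr1 big1 ?addr0// => i /eqP ik.
by case: eqP => [ki|_]; [case: ik; exact/val_inj|rewrite mulr0].
Qed.

Lemma coef_add1Xn (R : comNzRingType) n k :
  ((1 + 'X) ^+ n : {poly R})`_k = 'C(n, k)%:R.
Proof.
rewrite exprDn; under eq_bigr do rewrite expr1n mul1r -scaler_nat.
rewrite -(poly_def n.+1 (fun i => 'C(n, i)%:R)) coef_poly.
by case: ltnP => // nk; rewrite bin_small.
Qed.

(** * Polynomials with negative roots *)

Section roots.
Context {C : numClosedFieldType}.
Implicit Types (p : {poly C}) (r : seq C) (z a : C).

Lemma deriv_prod_XsubC r z : ~~ root (\prod_(x <- r) ('X - x%:P)) z ->
  (\prod_(x <- r) ('X - x%:P))^`().[z] =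
  (\prod_(x <- r) ('X - x%:P)).[z] * \sum_(x <- r) (z - x)^-1.
Proof.
elim: r => [|x r IH]; first by rewrite !big_nil derivC horner0 mulr0.
rewrite !big_cons rootM negb_or root_XsubC => /andP[zx /IH {}IH].
rewrite derivM derivXsubC mul1r hornerD hornerM IH !hornerM hornerXsubC.
by field; rewrite subr_eq0.
Qed.

(* At a root z of a p + X p', dividing by p(z) and conjugating denominators
   gives - a = A + B z with A, B >= 0. *)
Lemma negative_roots_euler p a : p != 0 -> 0 < a ->
  (forall z, root p z -> z < 0) ->
  forall z, root (a *: p + 'X * p^`()) z -> z < 0.
Proof.
move=> p0 a0 pn z rz; have [/pn//|pz] := boolP (root p z).
have [r] := closed_field_poly_normal p.
have : lead_coef p != 0 by rewrite lead_coef_eq0.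
move: (lead_coef p) => c c0 pE.
have xn x : x \in r -> x < 0.
  by move=> xr; apply: pn; rewrite pE rootZ// root_prod_XsubC.
have qz : ~~ root (\prod_(x <- r) ('X - x%:P)) z.
  by move: pz; rewrite pE rootZ.
have zx x : x \in r -> z - x != 0.
  move=> xr; apply: contra qz; rewrite subr_eq0 => /eqP ->.
  by rewrite root_prod_XsubC.
have E : a + z * \sum_(x <- r) (z - x)^-1 = 0.
  move: rz; rewrite /root hornerD hornerZ hornerM hornerX pE derivZ !hornerZ.
  rewrite (deriv_prod_XsubC qz) => /eqP H; apply: (mulfI (x := p.[z])).
    by rewrite -[_ == 0]/(root p z).
  by rewrite mulr0 -[RHS]H pE hornerZ; ring.
pose A := \sum_(x <- r) `|z| ^+ 2 / `|z - x| ^+ 2.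
pose B := \sum_(x <- r) - x / `|z - x| ^+ 2.
have AB : z * \sum_(x <- r) (z - x)^-1 = A + z * B.
  rewrite /A /B !mulr_sumr -big_split/=; apply: eq_big_seq => x xr.
  have xR : x^* = x by apply/CrealP/ltr0_real/xn.
  rewrite !normCK rmorphB/= xR; field.
  by rewrite zx// -xR -rmorphB conjC_eq0 zx.
have A0 : 0 <= A by apply: sumr_ge0 => x _; rewrite divr_ge0// exprn_ge0.
have B0 : 0 <= B.
  rewrite /B big_seq; apply: sumr_ge0 => x xr.
  by rewrite divr_ge0 ?exprn_ge0// oppr_ge0 ltW// xn.
(* If B = 0 the equation reads a + A = 0, against a > 0; otherwise z = - (a + A) / B. *)
move: B0 E; rewrite AB le0r => /orP[/eqP ->|B0].
  by rewrite mulr0 addr0 => /eqP; rewrite gt_eqF// ltr_wpDr.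
move=> /eqP; rewrite addrA addr_eq0 => /eqP H.
have -> : z = - ((a + A) / B) by rewrite H mulNr opprK mulfK ?gt_eqF.
by rewrite oppr_lt0 divr_gt0// ltr_wpDr.
Qed.

(** Each factor z - x with x real has modulus at least |Im z|. This lower bound off the real line is
    what lets real-rootedness pass to a limit. *)
Lemma norm_horner_ge_Im p z : (forall x, root p x -> x \is Num.real) ->
  `|lead_coef p| * `|'Im z| ^+ (size p).-1 <= `|p.[z]|.
Proof.
move=> pR; have [->|p0] := eqVneq p 0.
  by rewrite lead_coef0 horner0 normr0 mul0r.
have [r pE] := closed_field_poly_normal p.
have lc0 : lead_coef p != 0 by rewrite lead_coef_eq0.
have xR x : x \in r -> x \is Num.real.
  by move=> xr; apply: pR; rewrite pE rootZ// root_prod_XsubC.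
have -> : (size p).-1 = size r by rewrite pE size_scale// size_prod_XsubC.
rewrite [in leRHS]pE hornerZ normrM ler_wpM2l//.
elim: r xR {pE} => [|x r IH] xR; first by rewrite big_nil hornerC normr1.
rewrite big_cons hornerM hornerXsubC normrM exprS ler_pM ?exprn_ge0//.
- have -> : 'Im z = 'Im (z - x).
    have /xR /Creal_ImP xI : x \in x :: r by rewrite mem_head.
    by rewrite raddfB/= xI subr0.
  rewrite -(@ler_pXn2r _ 2)// ?nnegrE// (normC2_Re_Im (z - x)).
  by rewrite real_normK ?Creal_Im// lerDr real_exprn_even_ge0// Creal_Re.
- by apply: IH => y yr; apply: xR; rewrite inE yr orbT.
Qed.

(** Cauchy-Schwarz against the all-ones vector, by induction; realness makes the squares
    nonnegative. *)
Lemma sum_sqr_le r : all (fun x => x \is Num.real) r ->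
  (\sum_(x <- r) x) ^+ 2 <= (size r)%:R * \sum_(x <- r) x ^+ 2.
Proof.
elim: r => [|x r IH]; first by rewrite !big_nil expr0n mulr0.
move=> /= /andP[xR rR]; rewrite !big_cons.
have /IH H := rR; pose S := \sum_(y <- r) y; pose Q := \sum_(y <- r) y ^+ 2.
rewrite -/S -/Q in H *.
have SR : S \is Num.real.
  by rewrite /S big_seq; apply: rpred_sum => y yr; exact: (allP rR).
have [r0|r0] := eqVneq (size r) 0%N.
  by rewrite /S /Q (size0nil r0) !big_nil !addr0 mul1r.
have n0 : 0 < (size r)%:R :> C by rewrite ltr0n lt0n.
rewrite -(ler_pM2l n0) -subr_ge0.
(* The new excess, scaled by the old length, is a multiple of the old excess plus a square. *)
have -> : (size r)%:R * ((size r).+1%:R * (x ^+ 2 + Q)) -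
    (size r)%:R * (x + S) ^+ 2 =
    (size r).+1%:R * ((size r)%:R * Q - S ^+ 2) + ((size r)%:R * x - S) ^+ 2.
  by rewrite -natr1; ring.
apply: addr_ge0; first by rewrite mulr_ge0 ?subr_ge0.
by apply: real_exprn_even_ge0 => //; rewrite rpredB// rpredM// realn.
Qed.

(* Newton's inequality for the three lowest coefficients, applied to the
   reciprocals y of the roots. *)
Lemma newton_low p n : (size p <= n.+1)%N -> p`_0 != 0 -> p`_0 \is Num.real ->
  (forall z, root p z -> z \is Num.real) ->
  (2 * n)%:R * p`_0 * p`_2 <= n.-1%:R * p`_1 ^+ 2.
Proof.
move=> sp p00 p0R pR.
have p0 : p != 0 by apply: contra_neq p00 => ->; rewrite coef0.
have [r pE] := closed_field_poly_normal p.
have lc0 : lead_coef p != 0 by rewrite lead_coef_eq0.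
have xP x : x \in r -> x \is Num.real /\ x != 0.
  move=> xr; have rx : root p x by rewrite pE rootZ// root_prod_XsubC.
  split; [exact: pR|apply: contra_neq p00 => x0].
  by rewrite -horner_coef0; move: rx; rewrite x0 => /eqP.
have sr : (size r <= n)%N.
  by rewrite -ltnS (leq_trans _ sp)// pE size_scale// size_prod_XsubC.
(* With factors normalised at 0, the low coefficients are symmetric functions of the reciprocals of
   the roots, whatever the degree. *)
have [c qE] : exists c, p = c *: \prod_(x <- r) (1 - x^-1 *: 'X).
  rewrite pE; exists (lead_coef p * \prod_(x <- r) - x); rewrite -scalerA; congr (_ *: _).
  elim: r xP {pE sr} => [|x r IH] xP; first by rewrite !big_nil scale1r.
  rewrite !big_cons IH => [|y yr]; last by apply: xP; rewrite inE yr orbT.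
  have [_ x0] := xP x (mem_head _ _).
  have -> : 'X - x%:P = - x *: (1 - x^-1 *: 'X).
    by rewrite scalerBr scalerA mulNr divff// scaleN1r opprK addrC scaleNr alg_polyC.
  by rewrite -scalerAl -scalerAr scalerA.
pose ys := [seq x^-1 | x <- r].
have yR : all (fun x => x \is Num.real) ys.
  by apply/allP => _ /mapP[x /xP[xR _] ->]; rewrite rpredV.
pose S := \sum_(y <- ys) y; pose Q := \sum_(y <- ys) y ^+ 2.
pose q := \prod_(y <- ys) (1 - y *: 'X).
have [q0 q1 q2] : [/\ q`_0 = 1, q`_1 = - S & q`_2 * 2 = S ^+ 2 - Q].
  rewrite /q /S /Q; elim: (ys) => [|y s [IH0 IH1 IH2]].
    by rewrite !big_nil !coef1/= oppr0 addr0 expr2 !mul0r.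
  have E k : ((1 - y *: 'X) * \prod_(j <- s) (1 - j *: 'X))`_k =
    (\prod_(j <- s) (1 - j *: 'X))`_k - y * (if k is k'.+1
       then (\prod_(j <- s) (1 - j *: 'X))`_k' else 0).
    by rewrite mulrBl mul1r -scalerAl coefB coefZ coefXM; case: k.
  rewrite !big_cons !E IH0 IH1 mulrBl IH2 mulr0 subr0; split=> //; ring.
have {}qE : p = c *: q by rewrite qE /q big_map.
have cR : c \is Num.real by move: p0R; rewrite qE coefZ q0 mulr1.
have SQ := sum_sqr_le yR.
rewrite -/S -/Q size_map in SQ.
have Q0 : 0 <= Q.
  rewrite /Q big_seq; apply: sumr_ge0 => y ys_y.
  by rewrite real_exprn_even_ge0//; exact: (allP yR).
have {}SQ : S ^+ 2 <= n%:R * Q.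
  by apply: (le_trans SQ); rewrite ler_wpM2r// ler_nat.
rewrite qE !coefZ q0 q1 mulr1 -subr_ge0.
case: n SQ {sp sr} => [|n] SQ; first by rewrite muln0 !mul0r subrr.
(* Since 2 q_2 = S^2 - Q, the difference of the two sides is c^2 ((n + 1) Q - S^2). *)
have -> : n.+1.-1%:R * (c * - S) ^+ 2 - (2 * n.+1)%:R * c * (c * q`_2) =
    c ^+ 2 * (n.+1%:R * (S ^+ 2 - q`_2 * 2) - S ^+ 2).
  by rewrite natrM -natr1 /=; ring.
rewrite q2 mulr_ge0 ?real_exprn_even_ge0// subr_ge0//.
by rewrite opprB addrC subrK.
Qed.

End roots.

(** * Multiplier sequences and limits that preserve negative roots *)

Section multipliers.
Context {R : realType}.
Implicit Types (p : {poly R}) (a b : R^nat).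

Lemma coef_complexify p k : (complexify p)`_k = (p`_k)%:C%C.
Proof. by rewrite coef_map. Qed.

Lemma horner_complexify p (x : R) : (complexify p).[x%:C%C] = (p.[x])%:C%C.
Proof. by rewrite /complexify horner_map. Qed.

Lemma complexify_eq0 p : (complexify p == 0) = (p == 0).
Proof. exact: map_poly_eq0. Qed.

(** Each pass of p |-> a_j p + X p' multiplies the coefficient of X^k by a_j + k. *)
Lemma coef_euler_iter n a N k :
  (iteri N (fun j p => a j *: p + 'X * p^`()) ((1 + 'X) ^+ n))`_k =
  'C(n, k)%:R * \prod_(j < N) (a j + k%:R).
Proof.
elim: N k => [|N IH] k /=.
  by rewrite big_ord0 mulr1 coef_add1Xn.
rewrite big_ord_recr/= coefD coefZ IH coefXM coef_deriv.
case: k => [|k]/=; first by rewrite addr0; ring.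
rewrite IH -mulr_natr; ring.
Qed.

Lemma negative_roots_add1Xn n :
  negative_roots (complexify ((1 + 'X) ^+ n : {poly R})).
Proof.
rewrite /complexify rmorphXn rmorphD/= rmorph1 map_polyX => z.
rewrite /root horner_exp !hornerE expf_eq0 => /andP[_].
by rewrite addrC addr_eq0 => /eqP ->; rewrite oppr_lt0 ltr01.
Qed.

Lemma negative_roots_euler_iter n a N : (forall j, 0 < a j) ->
  negative_roots (complexify
    (iteri N (fun j p => a j *: p + 'X * p^`()) ((1 + 'X) ^+ n))).
Proof.
move=> a0; elim: N => [|N IH]; first exact: negative_roots_add1Xn.
rewrite iteriS.
rewrite /complexify rmorphD/= rmorphM/= map_polyX -deriv_map map_polyZ.
apply: negative_roots_euler => //; last by rewrite ltcR.
rewrite complexify_eq0; apply/eqP => /(congr1 (fun p : {poly R} => p`_0)).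
rewrite coef_euler_iter coef0 bin0 mul1r => /eqP.
apply/negP; rewrite gt_eqF// prodr_gt0// => j _.
by rewrite addr0.
Qed.

(** Positive coefficients exclude real roots that are not negative. At a nonreal root z of p, the
    values of q_N would tend to 0, while their moduli are at least the coefficient of degree n times
    |Im z|^n, which tends to a positive number. *)
Lemma negative_roots_limit n (q : nat -> {poly R}) p :
  (size p <= n.+1)%N -> (forall k, (k <= n)%N -> 0 < p`_k) ->
  (forall N, size (q N) <= n.+1)%N -> (forall N, 0 < (q N)`_n) ->
  (forall k, (k <= n)%N -> (q N)`_k @[N --> \oo] --> p`_k) ->
  (forall N, negative_roots (complexify (q N))) ->
  negative_roots (complexify p).
Proof.
move=> sp p0 sq q0 qp qn z rz.
have psum (x : R) : 0 <= x -> 0 < p.[x].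
  move=> x0; rewrite (horner_coef_wide _ sp) big_ord_recl expr0 mulr1.
  rewrite ltr_pwDl ?p0//.
  apply: sumr_ge0 => i _; rewrite mulr_ge0 ?exprn_ge0//.
  by rewrite ltW// p0// lift0.
have [zR|znR] := boolP (z \is Num.real).
  have [//|] := real_ltP zR (@real0 R[i]).
  have zE : z = (complex.Re z)%:C%C by rewrite RRe_real.
  move: rz; rewrite zE /root horner_complexify lecR -(rmorph0 (real_complex R)).
  by move=> /eqP/complexI H /psum; rewrite H ltxx.
exfalso.
pose y := complex.Re `|'Im z|; pose m := complex.Re `|z|.
have yE : `|'Im z| = y%:C%C by rewrite RRe_real// normr_real.
have mE : `|z| = m%:C%C by rewrite RRe_real// normr_real.
have y0 : 0 < y.
  by rewrite -ltcR -yE normr_gt0; apply: contra znR => /eqP/Creal_ImP.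
(* As p(z) = 0, the value of q_N at z is that of q_N - p, bounded by the triangle inequality. *)
have H N : (q N)`_n * y ^+ n <= \sum_(k < n.+1) `|(q N)`_k - p`_k| * m ^+ k.
  have szq : size (q N) = n.+1.
    apply/eqP; rewrite eqn_leq sq/= ltnNge; apply/negP => s.
    by have := q0 N; rewrite nth_default// ltxx.
  rewrite -lecR rmorphM rmorphXn/= -yE rmorph_sum/=.
  have := @norm_horner_ge_Im _ (complexify (q N)) z.
  rewrite /complexify lead_coef_map size_map_poly szq lead_coefE szq/=.
  rewrite (ger0_norm (x := _%:C%C)); last by rewrite ler0c ltW.
  move=> /(_ (fun x rx => ltr0_real (qn N x rx))).
  move=> /le_trans; apply.
  have -> : (map_poly (real_complex R) (q N)).[z] = (complexify (q N - p)).[z].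
    by rewrite /complexify rmorphB hornerD hornerN/= (eqP rz) subr0.
  rewrite (@horner_coef_wide _ n.+1); last first.
    by rewrite size_map_poly (leq_trans (size_polyD _ _))// geq_max sq size_polyN.
  apply: (le_trans (ler_norm_sum _ _ _)); apply: ler_sum => k _.
  rewrite normrM normrX coef_map/= coefB mE.
  by rewrite rmorphM rmorphXn/= normc_def/= expr0n/= addr0 sqrtr_sqr.
have : p`_n * y ^+ n <= 0.
  rewrite [leRHS](_ : _ = \sum_(k < n.+1) `|p`_k - p`_k| * m ^+ k); last first.
    by rewrite big1// => k _; rewrite subrr normr0 mul0r.
  apply: (@ler_cvg_to _ \oo _ _ (fun N => (q N)`_n * y ^+ n)
    (fun N => \sum_(k < n.+1) `|(q N)`_k - p`_k| * m ^+ k)).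
  - by apply: cvgMr_tmp; exact: (qp _ (leqnn n)).
  - apply: cvg_big => [|k _]; first exact: add_continuous.
    apply: cvgMr_tmp; apply: cvg_norm.
    by apply: cvgB; [exact: (qp _ (ltn_ord k))|exact: cvg_cst].
  - by apply: nearW => N; exact: H.
by apply/negP; rewrite -ltNge mulr_gt0 ?exprn_gt0 ?p0.
Qed.

Lemma negative_roots_scale p x : 0 < x ->
  negative_roots (complexify p) ->
  negative_roots (complexify (p \Po (x *: 'X))).
Proof.
move=> x0 pn z; rewrite /complexify map_comp_poly/= /root horner_comp.
rewrite map_polyZ/= map_polyX hornerZ hornerX => /pn.
by rewrite pmulr_rlt0// ltcR.
Qed.

(** The approximants are c_N e_N(l_N X), with e_N obtained from (1 + X)^n by N Euler steps.
    Rescaling the variable supplies the factor l_N^k, and neither operation affects the sign of the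
    roots. *)
Lemma negative_roots_multiplier n a (l c g : R^nat) :
  (forall j, 0 < a j) -> (forall N, 0 < l N) -> (forall N, 0 < c N) ->
  (forall k, 0 < g k) ->
  (forall k, c N * l N ^+ k * \prod_(j < N) (a j + k%:R) @[N --> \oo] --> g k) ->
  negative_roots (complexify (\poly_(k < n.+1) ('C(n, k)%:R * g k))).
Proof.
move=> a0 l0 c0 g0 cg.
pose e N := iteri N (fun j p => a j *: p + 'X * p^`()) ((1 + 'X) ^+ n).
pose q N := c N *: (e N \Po (l N *: 'X)).
have qE N k : (q N)`_k =
    'C(n, k)%:R * (c N * l N ^+ k * \prod_(j < N) (a j + k%:R)).
  by rewrite coefZ coef_comp_scale coef_euler_iter; ring.
apply: (@negative_roots_limit n q).
- exact: size_poly.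
- by move=> k kn; rewrite coef_poly ltnS kn mulr_gt0// ltr0n bin_gt0.
- move=> N; apply/leq_sizeP => k nk.
  by rewrite qE bin_small// mul0r.
- move=> N; rewrite qE binn mul1r !mulr_gt0 ?exprn_gt0// prodr_gt0// => j _.
  by rewrite ltr_wpDr.
- move=> k kn; rewrite coef_poly ltnS kn.
  by under eq_cvg do rewrite qE; apply: cvgMl_tmp; exact: cg.
- move=> N z; rewrite /complexify map_polyZ/= rootZ; last first.
    by rewrite fmorph_eq0 gt_eqF.
  apply: negative_roots_scale => //; exact: negative_roots_euler_iter.
Qed.

End multipliers.

(** * Products of moments as limits of multiplier sequences *)

Section wallis.
Context {R : realType} (c : R^nat).
Hypothesis c_gt0 : forall k, 0 < c k.
Hypothesis c_noninc : forall k, c k.+1 <= c k.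
Hypothesis c_rec : forall k, k.+3%:R * c k.+2 = k.+2%:R * c k.

Let K k := \prod_(j < k) c j.

Let K_gt0 k : 0 < K k.
Proof. by apply: prodr_gt0. Qed.

(** The recurrence makes this product independent of k, so two consecutive factors of [K] multiply
    to a constant over k + 2. *)
Let cc_const k : k.+2%:R * c k * c k.+1 = 2 * c 0 * c 1.
Proof.
by elim: k => [//|k <-]; rewrite -mulrA mulrCA c_rec; ring.
Qed.

(** Pairing the last 2N factors of K(2N + k) by [cc_const]. Solved for K(k), this exhibits N
    multipliers that are linear in k. *)
Let K_add2N N k :
  K (N.*2 + k)%N * \prod_(j < N) (j.+1.*2 + k)%:R = (2 * c 0 * c 1) ^+ N * K k.
Proof.
elim: N => [|N IH]; first by rewrite big_ord0 mulr1 expr0 mul1r.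
rewrite big_ord_recr/= doubleS !addSn exprS -mulrA -IH -(cc_const (N.*2 + k)).
rewrite {1}/K 2!big_ord_recr/= -/(K _); ring.
Qed.

(** Telescoping reduces this to consecutive ratios. They are at least 1 by monotonicity, and (M + 2)
    c_M = (M + 3) c_(M+2) <= (M + 3) c_(M+1) bounds them by 1 + 1/(M + 2). *)
Let c_ratio_cvg s k : c (N.*2 + s)%N / c (N.*2 + s + k)%N @[N --> \oo] --> (1 : R).
Proof.
elim: k => [|k IH].
  by under eq_cvg do rewrite addn0 divff ?gt_eqF//; exact: cvg_cst.
rewrite -[1]mulr1.
rewrite (_ : (fun N => _) = (fun N => c (N.*2 + s)%N / c (N.*2 + s + k)%N)
  \* (fun N => c (N.*2 + s + k)%N / c (N.*2 + s + k.+1)%N)); last first.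
  by apply/funext => N /=; rewrite mulrA divfK ?gt_eqF.
apply: cvgM; first exact: IH.
apply: (@squeeze_cvgr _ _ _ _ (cst 1) (fun N => 1 + harmonic N)).
- apply: nearW => N; rewrite addnS /= ler_pdivlMr// mul1r c_noninc/=.
  set M := (_ + k)%N; rewrite ler_pdivrMr//.
  have M0 : 0 < M.+2%:R :> R by rewrite ltr0n.
  rewrite -(ler_pM2l M0) -c_rec mulrA.
  apply: (@le_trans _ _ (M.+3%:R * c M.+1)); first by rewrite ler_wpM2l.
  rewrite ler_wpM2r ?(ltW (c_gt0 _))// mulrDr mulr1 -natr1 lerD2l.
  rewrite ler_pdivlMr ?ltr0n// mul1r ler_nat /M -addnn; lia.
- exact: cvg_cst.
- by rewrite -[X in _ --> X]addr0; apply: cvgD; [exact: cvg_cst|exact: cvg_harmonic].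
Qed.

(** K(2N + s + k) has k more factors than K(2N + s), all asymptotic to c_(2N+s). Hence the
    dependence on k is asymptotically geometric, which a rescaling of the variable can absorb. *)
Let K_ratio_cvg s k :
  K (N.*2 + s)%N * c (N.*2 + s)%N ^+ k / K (N.*2 + s + k)%N @[N --> \oo] --> (1 : R).
Proof.
elim: k => [|k IH].
  by under eq_cvg do rewrite addn0 mulr1 divff ?gt_eqF//; exact: cvg_cst.
rewrite -[1]mulr1.
rewrite (_ : (fun N => _) = (fun N =>
  K (N.*2 + s)%N * c (N.*2 + s)%N ^+ k / K (N.*2 + s + k)%N)
  \* (fun N => c (N.*2 + s)%N / c (N.*2 + s + k)%N)); last first.
  apply/funext => N /=; rewrite addnS {2}/K big_ord_recr/= -/(K _) exprSr.
  by field; rewrite !gt_eqF.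
by apply: cvgM => //; exact: c_ratio_cvg.
Qed.

(** The shift s = 0 serves the cube and s = 1 the squeezed cube. *)
Lemma negative_roots_wallis n s : negative_roots (complexify
  (\poly_(k < n.+1) ('C(n, k)%:R * (2 ^+ (n - k) * \prod_(j < k + s) c j)))).
Proof.
pose w := 2 * c 0 * c 1.
have w0 : 0 < w by rewrite !mulr_gt0.
rewrite (_ : \poly_(k < n.+1) _ =
    \poly_(k < n.+1) ('C(n, k)%:R * (2 ^+ n / 2 ^+ k * K (k + s)%N))); last first.
  apply/polyP => k; rewrite !coef_poly ltnS; case: leqP => // kn.
  by rewrite expfB_cond// pnatr_eq0.
(* These choices come from solving [K_add2N] for K(k + s) and replacing K(2N + s + k) by K(2N + s)
   c_(2N+s)^k; the halves in the rescaling account for 2^(n-k). *)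
apply: (@negative_roots_multiplier _ n (fun j => (j.+1.*2 + s)%:R)
  (fun N => c (N.*2 + s)%N / 2) (fun N => 2 ^+ n * K (N.*2 + s)%N / w ^+ N)).
- by move=> j; rewrite ltr0n.
- by move=> N; rewrite divr_gt0.
- by move=> N; rewrite divr_gt0 ?mulr_gt0 ?exprn_gt0.
- by move=> N; rewrite !mulr_gt0 ?invr_gt0 ?exprn_gt0.
move=> k; rewrite -[X in _ --> X]mulr1.
rewrite (_ : (fun N => _) = (fun N => 2 ^+ n / 2 ^+ k * K (k + s)%N *
   (K (N.*2 + s)%N * c (N.*2 + s)%N ^+ k / K (N.*2 + s + k)%N))).
  by apply: cvgMl_tmp; exact: K_ratio_cvg.
apply/funext => N.
have := K_add2N N (k + s); rewrite -/w.
under eq_bigr do rewrite [(k + s)%N]addnC addnA natrD.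
rewrite /=.
set P := \prod_(j < N) _ => H.
have {H} -> : P = w ^+ N * K (k + s)%N / K (N.*2 + s + k)%N.
  by rewrite -H -addnA [(s + k)%N]addnC mulrAC divff ?mul1r// gt_eqF.
rewrite expr_div_n; field.
by rewrite !gt_eqF// ?exprn_gt0.
Qed.

End wallis.

(** * Moments of the semicircle *)

Section semicircle.
Context {R : realType}.
Implicit Types (p g : {poly R}) (u t : R).
Notation mu := (@lebesgue_measure R).

Lemma continuous_itv_integrable (f : R -> R) (a b : R) :
  continuous f -> mu.-integrable `[a, b] (EFin \o f).
Proof.
move=> cf; apply: continuous_compact_integrable; first exact: segment_compact.
exact: continuous_subspaceT.
Qed.

(** The integral of f up to x, minus F(x), has positive derivative inside the interval. Nothing is
    asked of [dF] at the endpoints, where it may blow up. *)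
Lemma FTC_lt (f F dF : R -> R) (a b : R) : a < b -> continuous f ->
  continuous F -> (forall x, a < x < b -> is_derive x 1 F (dF x)) ->
  (forall x, a < x < b -> dF x < f x) ->
  F b - F a < \int[mu]_(x in `[a, b]) f x.
Proof.
move=> ab cf cF dFE dFf.
pose J x := \int[mu]_(y in `[a, x]) f y.
have intf c : mu.-integrable `[a, c] (EFin \o f) by exact: continuous_itv_integrable.
have Jd x : a < x < b -> derivable J x 1 /\ derive1 J x = f x.
  move=> /andP[ax xb]; apply: (continuous_FTC1_closed (u := b)) => //.
  exact: cf.
pose K := J \- F.
have Kd x : a < x < b -> derivable K x 1 /\ derive1 K x = f x - dF x.
  move=> /[dup] xab /Jd[Jx1 Jx2]; have [Fx1 Fx2] := dFE x xab.
  split; first exact: derivableB.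
  by rewrite derive1E (deriveB Jx1 Fx1) Fx2 -derive1E Jx2.
have : K a < K b.
  apply: (@gtr0_derive1_lt_cc _ K a b) => //.
  - by move=> x; rewrite in_itv/= => /Kd[].
  - by move=> x; rewrite in_itv/= => /[dup] /Kd[_ ->] /dFf; rewrite subr_gt0.
  - move=> x; apply: cvgB; last exact: (continuous_subspaceT cF).
    exact: (parameterized_integral_continuous (ltW ab) (intf b)).
  - by rewrite in_itv/= lexx ltW.
  - by rewrite in_itv/= lexx ltW.
by rewrite /K/= /J set_itv1 Rintegral_set1 sub0r ltrBrDl addrC.
Qed.

Definition semicircle u : R := Num.sqrt (1 - u ^+ 2).

Lemma semicircle_ge0 u : 0 <= semicircle u.
Proof. exact: sqrtr_ge0. Qed.

Lemma semicircle_le1 u : semicircle u <= 1.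
Proof. by rewrite -[leRHS]sqrtr1 ler_wsqrtr// gerBl sqr_ge0. Qed.

Lemma semicircle_end u : u ^+ 2 = 1 -> semicircle u = 0.
Proof. by move=> u1; rewrite /semicircle u1 subrr sqrtr0. Qed.

Lemma sqr_semicircle u : -1 < u < 1 -> semicircle u ^+ 2 = 1 - u ^+ 2.
Proof. by move=> u1; rewrite sqr_sqrtr//; nra. Qed.

Lemma semicircle_gt0 u : -1 < u < 1 -> 0 < semicircle u.
Proof. by move=> u1; rewrite sqrtr_gt0; nra. Qed.

Lemma continuous_semicircle : continuous semicircle.
Proof.
move=> u; apply: (@continuous_comp _ _ _ (fun u => 1 - u ^+ 2) Num.sqrt).
  by apply: cvgB; [exact: cvg_cst|exact: exprn_continuous].
exact: sqrt_continuous.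
Qed.

Lemma is_derive_semicircle u : -1 < u < 1 ->
  is_derive u 1 semicircle (- u / semicircle u).
Proof.
move=> u1; have s0 := semicircle_gt0 u1.
have u0 : 0 < 1 - u ^+ 2 by nra.
have H := is_derive1_sqrt u0.
rewrite (_ : semicircle = Num.sqrt \o (fun u => 1 - u ^+ 2))//.
apply: is_derive_eq.
by rewrite /GRing.scale/= /semicircle; field; rewrite gt_eqF.
Qed.

Lemma continuous_horner_semicircle p : continuous (fun u => p.[semicircle u]).
Proof.
move=> u; apply: (@continuous_comp _ _ _ semicircle (horner p)).
  exact: continuous_semicircle.
exact: continuous_horner.
Qed.

Definition circle_moment k : R := \int[mu]_(u in `[(-1), 1]) semicircle u ^+ k.
Local Notation c := circle_moment.

Lemma integrable_horner_semicircle p a b :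
  mu.-integrable `[a, b] (EFin \o (fun u => p.[semicircle u])).
Proof. exact/continuous_itv_integrable/continuous_horner_semicircle. Qed.

Lemma integrable_exp_semicircle k a b :
  mu.-integrable `[a, b] (EFin \o (fun u => semicircle u ^+ k)).
Proof.
have := @integrable_horner_semicircle 'X^k a b.
rewrite (_ : (fun u => _) = (fun u => semicircle u ^+ k))//.
by apply/funext => u; rewrite hornerXn.
Qed.

Lemma Rintegral_horner_semicircle n p : (size p <= n)%N ->
  \int[mu]_(u in `[(-1), 1]) p.[semicircle u] = \sum_(k < n) p`_k * c k.
Proof.
move=> sp; under eq_Rintegral do rewrite (horner_coef_wide _ sp).
elim: n {sp} => [|n IH].
  under eq_Rintegral do rewrite big_ord0.
  by rewrite big_ord0 Rintegral_cst// mul0r.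
under eq_Rintegral do rewrite big_ord_recr/=.
rewrite RintegralD//; last 2 first.
- have := @integrable_horner_semicircle (\poly_(k < n) p`_k) (-1) 1.
  by congr (_.-integrable _ _); apply/funext => u /=; rewrite horner_poly.
- have := @integrable_horner_semicircle (p`_n *: 'X^n) (-1) 1.
  by congr (_.-integrable _ _); apply/funext => u /=; rewrite hornerZ hornerXn.
by rewrite IH big_ord_recr/= RintegralZl//; exact: integrable_exp_semicircle.
Qed.

Lemma Rintegral_cst_N11 x : \int[mu]_(y in `[(-1), 1]) x = 2 * x.
Proof.
rewrite Rintegral_cst// mulrC; congr (_ * _).
transitivity (fine (2 : R)%:E) => //; congr fine.
apply: etrans (lebesgue_measure_itv _) _ => /=.
by rewrite lte_fin gtrN// -EFinD opprK.
Qed.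

Lemma circle_moment0 : c 0 = 2.
Proof.
by rewrite /c; under eq_Rintegral do rewrite expr0; rewrite Rintegral_cst_N11 mulr1.
Qed.

Lemma circle_moment_noninc k : c k.+1 <= c k.
Proof.
apply: le_Rintegral => //; try exact: integrable_exp_semicircle.
move=> u _; rewrite exprS ler_piMl ?semicircle_le1//.
by rewrite exprn_ge0// semicircle_ge0.
Qed.

Lemma is_derive_horner_semicircle p u : -1 < u < 1 ->
  is_derive u 1 (fun u => p.[semicircle u])
    (p^`().[semicircle u] * (- u / semicircle u)).
Proof.
move=> u1; have H := is_derive_semicircle u1.
have Hp : is_derive (semicircle u) 1 (horner p) (p^`().[semicircle u]).
  by split; [exact: derivable_horner|rewrite derivE derive1E].
exact: (is_derive1_comp Hp H).
Qed.

(** The function u (1 - u^2)^((k+2)/2) vanishes at -1 and 1, so its derivative, (k + 3) s^(k+2) - (k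
    + 2) s^k with s = sqrt(1 - u^2), integrates to 0. *)
Lemma circle_moment_rec k : k.+3%:R * c k.+2 = k.+2%:R * c k.
Proof.
pose p : {poly R} := k.+3%:R *: 'X^(k.+2) - k.+2%:R *: 'X^k.
pose F : R -> R := (id : R -> R) * (fun u => ('X^(k.+2)).[semicircle u]).
have cF : continuous F.
  by move=> u; apply: cvgM; [exact: cvg_id|exact: continuous_horner_semicircle].
have dF (u : R) : -1 < u < 1 -> is_derive u 1 F p.[semicircle u].
  move=> u1; have H := @is_derive_horner_semicircle ('X^(k.+2)) _ u1.
  rewrite /F; apply: is_derive_eq.
  have := sqr_semicircle u1; have := semicircle_gt0 u1.
  rewrite /p hornerD hornerN !hornerZ derivXn hornerMn !hornerXn.
  move: (semicircle u) => s s0 s2.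
  change (u * (s ^+ k.+1 *+ k.+2 * (- u / s)) + s ^+ k.+2 * 1 =
    k.+3%:R * s ^+ k.+2 - k.+2%:R * s ^+ k).
  transitivity (s ^+ k.+2 - k.+2%:R * u ^+ 2 * s ^+ k).
    by rewrite -(mulr_natr (s ^+ k.+1)) [s ^+ k.+1]exprS; field; rewrite gt_eqF.
  have -> : u ^+ 2 = 1 - s ^+ 2 by rewrite s2; ring.
  by rewrite !exprS -[k.+3%:R]natr1; ring.
have : \int[mu]_(u in `[(-1), 1]) p.[semicircle u] = F 1 - F (-1).
  have N11 : (-1 : R) < 1 by rewrite gtrN.
  rewrite /Rintegral (@continuous_FTC2 _ (fun u => p.[semicircle u]) F)//.
  - exact/continuous_subspaceT/continuous_horner_semicircle.
  - split.
    + by move=> u; rewrite in_itv/= => /dF[].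
    + exact/cvg_at_right_filter/cF.
    + exact/cvg_at_left_filter/cF.
  - by move=> u; rewrite in_itv/= => /dF[_ <-]; rewrite derive1E.
rewrite (@Rintegral_horner_semicircle k.+3); last first.
  rewrite (leq_trans (size_polyD _ _))// geq_max size_polyN.
  by rewrite !(leq_trans (size_scale_leq _ _))// size_polyXn// ltnW.
rewrite /F !fctE !hornerXn !semicircle_end ?sqrrN ?expr1n// !expr0n/= !mulr0 subrr.
rewrite !big_ord_recr/= big1 ?add0r => [|i _]; last first.
  by rewrite coefB !coefZ !coefXn !ltn_eqF ?mulr0 ?subrr ?mul0r// (ltn_trans (ltn_ord i)).
rewrite !coefB !coefZ !coefXn !eqxx.
have [-> -> -> ->] : [/\ (k == k.+2) = false, (k.+1 == k.+2) = false,
  (k.+1 == k) = false & (k.+2 == k) = false] by split; lia.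
rewrite !mulr0 !mulr1 => H; apply/eqP; rewrite -subr_eq0 -[X in _ == X]H; apply/eqP.
ring.
Qed.

(* With r = sqrt (1 - u^2), the function F u = u r g(r) / (1 + r) vanishes at -1
   and 1, and its derivative is the integrand minus g(r) / (r (1 + r)). *)
Lemma Rintegral_deriv_gt0 g : (forall x, 0 <= x <= 1 -> 0 < g.[x]) ->
  0 < \int[mu]_(u in `[(-1), 1]) (g - (1 - 'X) * g^`()).[semicircle u].
Proof.
move=> g0.
pose d u := (1 + 'X : {poly R}).[semicircle u].
have d0 u : 0 < d u by rewrite /d !hornerE ltr_pwDl// semicircle_ge0.
pose F : R -> R := (id : R -> R) *
  ((fun u => ('X * g).[semicircle u]) * (fun u => (d u)^-1)).
have cF : continuous F.
  move=> u; apply: cvgM; first exact: cvg_id.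
  apply: cvgM; first exact: continuous_horner_semicircle.
  by apply: cvgV; [rewrite gt_eqF ?d0|exact: continuous_horner_semicircle].
have N11 : (-1 : R) < 1 by rewrite gtrN.
pose q := g - (1 - 'X) * g^`().
have := @FTC_lt _ F (fun u => q.[semicircle u] -
    g.[semicircle u] / (semicircle u * (1 + semicircle u))) (-1) 1 N11
  (@continuous_horner_semicircle q) cF; rewrite {}/q.
have F0 (u : R) : u ^+ 2 = 1 -> F u = 0.
  by move=> u1; rewrite /F !fctE hornerM hornerX semicircle_end// !mul0r mulr0.
rewrite !F0 ?sqrrN ?expr1n// subrr.
apply => u u1; last first.
  rewrite gtrDl oppr_lt0 divr_gt0 ?g0 ?semicircle_ge0 ?semicircle_le1//.
  by rewrite mulr_gt0 ?semicircle_gt0// ltr_pwDl ?semicircle_ge0.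
have H1 := @is_derive_horner_semicircle ('X * g) _ u1.
have H2 := @is_derive_horner_semicircle (1 + 'X) _ u1.
have H3 := @is_deriveV _ d u _ 1 (lt0r_neq0 (d0 u)) H2.
rewrite /F; apply: is_derive_eq.
have dE : d u = 1 + semicircle u by rewrite /d hornerD hornerC hornerX.
have s0 := semicircle_gt0 u1; have := sqr_semicircle u1.
have d'E : (1 + 'X : {poly R})^`() = 1 by rewrite derivD derivX derivC add0r.
rewrite !hornerD !hornerN !hornerM !hornerD !hornerN !hornerX derivM derivX !hornerC.
rewrite hornerD !hornerM hornerC hornerX d'E hornerC.
change (semicircle u ^+ 2 = 1 - u ^+ 2 ->
  u * ((semicircle u * g.[semicircle u]) *
    (- d u ^- 2 * (1 * (- u / semicircle u))) +
    (d u)^-1 * ((1 * g.[semicircle u] + semicircle u * g^`().[semicircle u])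
       * (- u / semicircle u))) + ('X * g).[semicircle u] * (d u)^-1 * 1 =
  g.[semicircle u] - (1 - semicircle u) * g^`().[semicircle u] -
    g.[semicircle u] / (semicircle u * (1 + semicircle u))).
rewrite hornerM hornerX dE; move: (g.[_]) (g^`().[_]) s0 => G G'.
move: (semicircle u) => s s0 s2.
transitivity (u ^+ 2 * (G / (1 + s) ^+ 2 - (G + s * G') / (s * (1 + s))) + s * G / (1 + s)).
  by field; rewrite !gt_eqF// addr_gt0.
have -> : u ^+ 2 = 1 - s ^+ 2 by rewrite s2; ring.
by field; rewrite !gt_eqF// addr_gt0.
Qed.

(** The recurrence propagates positivity from c_0 = 2 to even indices, and c_k >= c_(2k) by
    monotonicity. *)
Lemma circle_moment_gt0 k : 0 < c k.
Proof.
have even j : 0 < c j.*2.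
  elim: j => [|j IH]; first by rewrite circle_moment0.
  rewrite -(@pmulr_rgt0 _ (j.*2.+3)%:R) ?ltr0n// doubleS circle_moment_rec.
  by rewrite mulr_gt0// ltr0n.
apply: (lt_le_trans (even k)); rewrite -addnn.
elim: {1}k => [|j IH]; first by rewrite add0n.
by rewrite addSn (le_trans (circle_moment_noninc _)).
Qed.

Lemma circle_moment_lt : c 1 ^+ 2 < c 0 * c 2.
Proof.
(* p = (1 - X) (X - 7/10)^2; that its integral is nonnegative gives c_1 < 8/5. *)
pose p : {poly R} := Poly [:: 49 / 100; - (189 / 100); 24 / 10; -1].
have : 0 <= \int[mu]_(u in `[(-1), 1]) p.[semicircle u].
  apply: Rintegral_ge0 => u _; rewrite horner_Poly/=.
  have := semicircle_le1 u; move: (semicircle u) => s s1.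
  rewrite [leRHS](_ : _ = (1 - s) * (s - 7 / 10) ^+ 2); last by field.
  by rewrite mulr_ge0 ?sqr_ge0 ?subr_ge0.
rewrite (@Rintegral_horner_semicircle 4); last exact: size_Poly.
rewrite !big_ord_recr big_ord0 !coef_Poly/= add0r.
have := circle_moment_rec 1; have := circle_moment_rec 0.
have := circle_moment_gt0 1; rewrite circle_moment0.
move: (c 1) (c 2) (c 3) => x y z x0 H1 H2 H3.
have yE : y = 4 / 3 by lra.
have zE : z = 3 / 4 * x by lra.
subst y z.
(* The bound 8/5 suffices: c_0 c_2 = 8/3 exceeds 64/25. *)
have : x < 16 / 10 by lra.
nra.
Qed.

(** The operator T, given by its coefficients; [integral_semicircle_op] is its integral form. *)
Definition semicircle_op p : {poly R} := 'X * \poly_(k < size p) (p`_k * c k).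

Lemma horner_semicircle_op p t : (semicircle_op p).[t] =
  \sum_(k < size p) p`_k * c k * t ^+ k.+1.
Proof.
rewrite hornerM hornerX horner_poly mulr_sumr; apply: eq_bigr => k _.
by rewrite exprS; ring.
Qed.

Lemma continuous_horner_sqrt p t (d : R -> R) : continuous d ->
  continuous (fun y => p.[Num.sqrt (t ^+ 2 - d y ^+ 2)]).
Proof.
move=> cd y.
apply: (@continuous_comp _ _ _ (fun y => Num.sqrt (t ^+ 2 - d y ^+ 2)) (horner p)).
  apply: (@continuous_comp _ _ _ (fun y => t ^+ 2 - d y ^+ 2) Num.sqrt).
    apply: cvgB; first exact: cvg_cst.
    apply: (@continuous_comp _ _ _ d (fun x => x ^+ 2)); first exact: cd.
    exact: exprn_continuous.
  exact: sqrt_continuous.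
exact: continuous_horner.
Qed.

(** The substitution y = t u turns sqrt(t^2 - y^2) into t sqrt(1 - u^2). It degenerates at t = 0,
    where both sides vanish. *)
Lemma integral_semicircle_op p t : 0 <= t ->
  (\int[mu]_(y in `[(- t)%R, t]) (p.[Num.sqrt (t ^+ 2 - y ^+ 2)])%:E =
   ((semicircle_op p).[t])%:E)%E.
Proof.
rewrite le_eqVlt => /predU1P[<-|t0].
  by rewrite oppr0 set_itv1 integral_set1 hornerM hornerX mul0r.
pose G (y : R) := p.[Num.sqrt (t ^+ 2 - y ^+ 2)].
have cG : continuous G by apply: (@continuous_horner_sqrt p t id) => y; exact: cvg_id.
have tF (u : R) : is_derive u 1 ( *%R t) t.
  by rewrite (_ : *%R t = t *: id)//; apply: is_derive_eq; rewrite /GRing.scale/= mulr1.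
have dF : derive1 ( *%R t) = cst t.
  by apply/funext => u; rewrite derive1E; have [_ ->] := tF u.
have := @integration_by_substitution_increasing _ ( *%R t) G (-1) 1.
rewrite mulrN1 mulr1 dF => ->; last 7 first.
- by rewrite (@le_trans _ _ 0)// oppr_le0.
- by move=> x y _ _; rewrite ltr_pM2l.
- by move=> x _; exact: cvg_cst.
- exact: is_cvg_cst.
- exact: is_cvg_cst.
- have ct : continuous ( *%R t) by exact: mulrl_continuous.
  split; first by move=> u _; have [] := tF u.
    exact/cvg_at_right_filter/ct.
  exact/cvg_at_left_filter/ct.
- exact: continuous_subspaceT.
have -> : (semicircle_op p).[t] =
    \int[mu]_(u in `[(-1), 1]) (t *: (p \Po (t *: 'X))).[semicircle u].
  rewrite (@Rintegral_horner_semicircle (size p)); last first.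
    apply/leq_sizeP => k pk; rewrite coefZ coef_comp_scale nth_default//.
    by rewrite mul0r mulr0.
  rewrite horner_semicircle_op; apply: eq_bigr => k _.
  by rewrite coefZ coef_comp_scale exprS; ring.
rewrite /Rintegral fineK; last first.
  by apply: integrable_fin_num => //; exact: integrable_horner_semicircle.
apply: eq_integral => u; rewrite inE/= in_itv/= => /andP[u1 u2].
rewrite !fctE/= hornerZ horner_comp hornerZ hornerX mulrC /G /semicircle.
congr (_ * p.[_])%:E; rewrite exprMn -{1}[t ^+ 2]mulr1 -mulrBr sqrtrM ?sqr_ge0//.
by rewrite sqrtr_sqr gtr0_norm.
Qed.

End semicircle.

(** * Volumes by slicing *)

Section slices.
Context {R : realType}.
Notation mu := (@lebesgue_measure R).
Notation RT := (measurableTypeR R).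
Implicit Types (p : {poly R}) (r t : R).

(** The product measure integrates the lengths of fibres over the first n coordinates; its
    uniqueness allows the opposite order. *)
Lemma lebesgue_measure_tupleS n (A : set (n.+1.-tuple RT)) : measurable A ->
  (lebesgue_measure_tuple n.+1 A =
   \int[mu]_y lebesgue_measure_tuple n [set x | A (tuple_snoc (x, y))])%E.
Proof.
move=> mA; pose X := @tuple_snoc R n @^-1` A.
have mX : measurable X.
  by rewrite -[X]setTI; exact: measurable_tuple_snoc.
have H := @product_measure_unique _ _ _ _ _ (lebesgue_measure_tuple n) mu
  (lebesgue_measure_tuple n \x^ mu)%E.
rewrite /= /snoc_measure /pushforward H//; last first.
  by move=> B C mB mC; exact: product_measure2E.
rewrite /product_measure2; apply: eq_integral => y _ /=.
by congr (lebesgue_measure_tuple n _); apply/seteqP; split=> x /=; rewrite /ysection/= inE.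
Qed.

Lemma vol_slice n (phi : 'rV[R]_n -> R) (psi : R -> R) r :
  measurable_fun [set: n.-tuple RT] (fun t : n.-tuple RT => phi (\row_i (tnth t i : R))) ->
  measurable_fun [set: RT] psi ->
  (vol [set z : 'rV[R]_n.+1 |
     phi (\row_i z ord0 (widen_ord (leqnSn n) i)) + psi (z ord0 ord_max) <= r]%R =
   \int[mu]_y vol [set x | phi x + psi y <= r]%R)%E.
Proof.
move=> mphi mpsi; rewrite /vol lebesgue_measure_tupleS.
  apply: eq_integral => y _; congr (lebesgue_measure_tuple n _).
  apply/seteqP; split=> x /=; rewrite mxE tnth_snoc_max;
    congr (phi _ + _ <= _); apply/rowP => i; by rewrite !mxE tnth_snoc_widen.
rewrite /=.
pose f (t : n.+1.-tuple RT) := phi (\row_i tnth (tuple_unsnoc t).1 i) + psi (tuple_unsnoc t).2.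
rewrite (_ : mkset _ = f @^-1` `]-oo, r]); last first.
  apply/seteqP; split=> t /=; rewrite in_itv/= /f/= !mxE;
    congr (phi _ + _ <= _); apply/rowP => i; by rewrite !mxE tnth_mktuple.
rewrite -[X in measurable X]setTI.
have mf : measurable_fun setT f.
  apply: measurable_funD.
    by apply: (measurableT_comp mphi); apply: (measurableT_comp measurable_fst);
      exact: measurable_tuple_unsnoc.
  by apply: (measurableT_comp mpsi); apply: (measurableT_comp measurable_snd);
      exact: measurable_tuple_unsnoc.
by apply: mf.
Qed.

Lemma vol_slice1 n (phi : 'rV[R]_n -> R) (psi : R -> R) r :
  measurable_fun [set: n.-tuple RT] (fun t : n.-tuple RT => phi (\row_i (tnth t i : R))) ->
  measurable_fun [set: RT] psi ->
  (vol [set z : 'rV[R]_(n + 1) |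
     phi (lsubmx z) + psi (z ord0 (rshift n ord0)) <= r]%R =
   \int[mu]_y vol [set x | phi x + psi y <= r]%R)%E.
Proof.
move=> mphi mpsi; rewrite -vol_slice//.
(* The dimensions n.+1 and n + 1 are not convertible; a variable k lets the equation be
   eliminated. *)
suff H k (e : n.+1 = k) : (vol [set z : 'rV[R]_n.+1 |
     phi (\row_i z ord0 (widen_ord (leqnSn n) i)) + psi (z ord0 ord_max) <= r]%R =
    vol [set z : 'rV[R]_k |
     phi (\row_i z ord0 (cast_ord e (widen_ord (leqnSn n) i)))
       + psi (z ord0 (cast_ord e ord_max)) <= r]%R)%E.
  have e : n.+1 = (n + 1)%N by rewrite addn1.
  rewrite (H _ e); congr vol; apply/seteqP; split=> z /=;
  (have -> : rshift n ord0 = cast_ord e ord_max by apply/val_inj; rewrite /= addn0);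
  congr (phi _ + _ <= _); apply/rowP => i; rewrite !mxE; congr (z _ _); exact/val_inj.
case: _ / e; congr vol; apply/seteqP; split=> z /=; rewrite cast_ord_id;
  congr (phi _ + _ <= _); apply/rowP => i; by rewrite !mxE cast_ord_id.
Qed.

(* The distance from x to the interval [-1, 1] if b, and to 0 otherwise. *)
Definition coord_dist (b : bool) (x : R) : R :=
  if b then Num.max 0 (`|x| - 1) else `|x|.

Lemma continuous_coord_dist b : continuous (coord_dist b).
Proof.
case: b => x; last exact: norm_continuous.
apply: (@continuous_max _ _ (cst 0) (fun x : R => `|x| - 1)).
  exact: cst_continuous.
by apply: cvgB; [exact: norm_continuous|exact: cvg_cst].
Qed.

Lemma coord_dist_ge0 b x : 0 <= coord_dist b x.
Proof. by case: b => /=; rewrite ?normr_ge0// le_max lexx. Qed.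

Lemma Rintegral_split (f : R -> R) (a b c : R) : continuous f -> a <= b <= c ->
  \int[mu]_(y in `[a, c]) f y =
  \int[mu]_(y in `[a, b]) f y + \int[mu]_(y in `[b, c]) f y.
Proof.
move=> cf /andP[ab bc]; rewrite addrC; apply/eqP; rewrite -subr_eq; apply/eqP.
rewrite Rintegral_itvB ?bnd_simp//; last exact: continuous_itv_integrable.
rewrite Rintegral_itv_obnd_cbnd//.
apply: (integrableS _ _ _ (continuous_itv_integrable b c cf)) => //.
exact: subset_itv_oc_cc.
Qed.

Lemma Rintegral_shift (f : R -> R) (a b s : R) : continuous f -> a <= b ->
  \int[mu]_(y in `[a + s, b + s]) f y = \int[mu]_(y in `[a, b]) f (y + s).
Proof.
move=> cf ab; rewrite /Rintegral; congr fine.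
have dF (u : R) : is_derive u 1 ( +%R^~ s) (1 : R).
  by rewrite (_ : +%R^~ s = id + cst s)//; apply: is_derive_eq; rewrite addr0.
have ddF : derive1 ( +%R^~ s) = cst (1 : R).
  by apply/funext => u; rewrite derive1E; have [_ ->] := dF u.
have cF : continuous ( +%R^~ s).
  by move=> u; apply: cvgD; [exact: cvg_id|exact: cvg_cst].
have := @integration_by_substitution_increasing _ ( +%R^~ s) f a b.
rewrite ddF => ->.
- by apply: eq_integral => y _; rewrite fctE/= mulr1.
- by [].
- by move=> x y _ _; rewrite ltrD2r.
- by move=> x _; exact: cvg_cst.
- exact: is_cvg_cst.
- exact: is_cvg_cst.
- split; first by move=> u _; have [] := dF u.
    exact/cvg_at_right_filter/cF.
  exact/cvg_at_left_filter/cF.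
- exact: continuous_subspaceT.
Qed.

(** The effect of adding one coordinate: 2 + T for a factor [-1, 1], where the slices through the
    body contribute 2 p, and T for a single point. *)
Definition slice_op b p := (if b then 2 *: p else 0) + semicircle_op p.

Lemma integral_slices b p r (f : R -> \bar R) : 0 <= r ->
  (forall y, coord_dist b y <= r ->
     f y = (p.[Num.sqrt (r ^+ 2 - coord_dist b y ^+ 2)])%:E) ->
  (forall y, r < coord_dist b y -> f y = 0%E) ->
  (\int[mu]_y f y = ((slice_op b p).[r])%:E)%E.
Proof.
move=> r0 fin fout.
pose g y := p.[Num.sqrt (r ^+ 2 - coord_dist b y ^+ 2)].
(* The integrand vanishes outside [-w, w]. *)
pose w := (if b then 1 else 0) + r.
have wP y : (y \in `[(- w), w]) = (coord_dist b y <= r).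
  rewrite in_itv/= -ler_norml /w; case: b {fin fout g w} => /=.
    by rewrite ge_max r0/= lerBlDl.
  by rewrite add0r.
have -> : (\int[mu]_y f y = \int[mu]_(y in `[(- w)%R, w]) (g y)%:E)%E.
  rewrite [RHS]integral_mkcond; apply: eq_integral => y _; rewrite patchE.
  case: ifPn; rewrite ?mem_setE wP => H; first exact: fin.
  by rewrite fout// ltNge.
have cg : continuous g by exact/continuous_horner_sqrt/continuous_coord_dist.
have C := integral_semicircle_op p r0.
clear fin fout wP; case: b @g @w cg => g w cg; last first.
  rewrite /w /slice_op !add0r -C; apply: eq_integral => y _.
  by rewrite /g /coord_dist real_normK// num_real.
rewrite -[LHS]fineK; last first.
  by apply: integrable_fin_num => //; exact: continuous_itv_integrable.
congr EFin; rewrite -/(Rintegral mu _ g) /w.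
pose h (y : R) := p.[Num.sqrt (r ^+ 2 - y ^+ 2)].
have ch : continuous h by apply: (@continuous_horner_sqrt _ p r id) => y; exact: cvg_id.
have {}C : \int[mu]_(y in `[(- r), r]) h y = (semicircle_op p).[r].
  by rewrite /Rintegral C.
(* On [-1, 1] the integrand is constantly p(r); the two outer pieces, moved inwards by 1, join into
   the integral over [-r, r]. *)
rewrite (@Rintegral_split g _ (-1))//; last by lra.
rewrite (@Rintegral_split g (-1) 1)//; last by lra.
rewrite (_ : \int[mu]_(y in `[(-1), 1]) g y = 2 * p.[r]); last first.
  rewrite -Rintegral_cst_N11; apply: eq_Rintegral => y.
  rewrite inE/= in_itv/= -ler_norml -subr_le0 /g /coord_dist => /max_idPl ->.
  by rewrite expr0n subr0 sqrtr_sqr ger0_norm.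
have -> : \int[mu]_(y in `[1, 1 + r]) g y = \int[mu]_(y in `[0, r]) g (y + 1).
  by rewrite -Rintegral_shift// add0r addrC.
have -> : \int[mu]_(y in `[- (1 + r), -1]) g y = \int[mu]_(y in `[- r, 0]) g (y + -1).
  by rewrite -Rintegral_shift ?add0r ?opprD 1?addrC//; lra.
rewrite (@eq_Rintegral _ _ _ mu _ h (fun y => g (y + -1))); last first.
  move=> y; rewrite inE/= in_itv/= /g /h /coord_dist => /andP[_ y0].
  by rewrite ler0_norm ?max_r; [congr (_.[Num.sqrt _]); ring|lra..].
rewrite (@eq_Rintegral _ _ _ mu _ h (fun y => g (y + 1))); last first.
  move=> y; rewrite inE/= in_itv/= /g /h /coord_dist => /andP[y0 _].
  by rewrite ger0_norm ?max_r; [congr (_.[Num.sqrt _]); ring|lra..].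
rewrite addrCA -Rintegral_split ?C ?/slice_op ?hornerD ?hornerZ//; lra.
Qed.

Lemma measurable_coord_sum b n : measurable_fun [set: n.-tuple RT]
  (fun t : n.-tuple RT => \sum_(i < n) coord_dist b ((\row_j (tnth t j : R)) ord0 i) ^+ 2).
Proof.
apply: measurable_sum => i.
under eq_fun do rewrite mxE.
apply: measurable_funX.
apply: (measurableT_comp (continuous_measurable_fun (@continuous_coord_dist b))).
exact: measurable_tnth.
Qed.

Definition coord_poly b n : {poly R} := iter n (slice_op b) 1.

(** Slicing off the last coordinate y leaves a set of the same kind, of radius sqrt(r^2 - d^2) with
    d = [coord_dist b y], or the empty set if d > r. *)
Lemma vol_coord b n r : 0 <= r ->
  vol [set x : 'rV[R]_n | \sum_(i < n) coord_dist b (x ord0 i) ^+ 2 <= r ^+ 2] =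
  ((coord_poly b n).[r])%:E.
Proof.
elim: n r => [|n IH] r r0.
  (* In dimension 0 the space is one point of mass 1. *)
  rewrite /vol/= diracE mem_set/= ?hornerC// big_ord0; exact: sqr_ge0.
rewrite (_ : mkset _ = [set z : 'rV[R]_n.+1 |
    \sum_(i < n) coord_dist b ((\row_j z ord0 (widen_ord (leqnSn n) j)) ord0 i) ^+ 2
      + coord_dist b (z ord0 ord_max) ^+ 2 <= r ^+ 2]); last first.
  apply/seteqP; split=> z/=; rewrite big_ord_recr/=; congr (_ + _ <= _);
  by apply: eq_bigr => i _; rewrite mxE.
rewrite (@vol_slice n (fun x => \sum_(i < n) coord_dist b (x ord0 i) ^+ 2)
  (fun y => coord_dist b y ^+ 2)); last 2 first.
- exact: measurable_coord_sum.
- apply: measurable_funX; exact: (continuous_measurable_fun (@continuous_coord_dist b)).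
apply: integral_slices => // y yr.
  rewrite -IH ?sqrtr_ge0// sqr_sqrtr ?subr_ge0 ?lerXn2r ?nnegrE ?coord_dist_ge0//.
  by congr vol; apply/seteqP; split=> x/=; rewrite lerBrDr.
rewrite (_ : mkset _ = set0) /vol ?measure0//.
apply/seteqP; split=> // x /=; apply/negP; rewrite -ltNge.
rewrite (@lt_le_trans _ _ (coord_dist b y ^+ 2))//.
  by rewrite ltrXn2r// ?nnegrE ?coord_dist_ge0.
by rewrite lerDr sumr_ge0// => i _; rewrite sqr_ge0.
Qed.

End slices.

(** * Nearest point projections and Steiner polynomials *)

Section dilations.
Context {R : realType}.
Implicit Types (p : {poly R}) (r t : R).

Definition sqnorm n (x : 'rV[R]_n) : R := \sum_i x ord0 i ^+ 2.

Lemma sqnorm_ge0 n (x : 'rV[R]_n) : 0 <= sqnorm x.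
Proof. by apply: sumr_ge0 => i _; exact: sqr_ge0. Qed.

Lemma sqnormZ n a (x : 'rV[R]_n) : sqnorm (a *: x) = a ^+ 2 * sqnorm x.
Proof. by rewrite mulr_sumr; apply: eq_bigr => i _; rewrite mxE exprMn. Qed.

Lemma sqnorm_eq0 n (x : 'rV[R]_n) : sqnorm x <= 0 -> x = 0.
Proof.
move=> x0; have : sqnorm x = 0 by apply/eqP; rewrite eq_le x0 sqnorm_ge0.
move=> /psumr_eq0P H; apply/rowP => i; rewrite mxE; apply/eqP.
by rewrite -sqrf_eq0 H// => j _; exact: sqr_ge0.
Qed.

Lemma unit_ballE n : unit_ball R n = [set x | sqnorm x <= 1].
Proof.
by apply/seteqP; split=> x; rewrite /unit_ball/= /sqnorm;
  under eq_bigr do rewrite real_normK ?num_real//.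
Qed.

(** If y = v + t b, the nearest point is no farther than v, hence within t; conversely x = P x + t b
    with b = (x - P x) / t. The case t = 0 is treated apart because of this division. *)
Lemma dilationE n (V : set 'rV[R]_n) (P : 'rV[R]_n -> 'rV[R]_n) t : 0 <= t ->
  (forall x, V (P x)) ->
  (forall x v, V v -> sqnorm (x - P x) <= sqnorm (x - v)) ->
  dilation V t = [set x | sqnorm (x - P x) <= t ^+ 2].
Proof.
move=> t0 VP nP; apply/seteqP; split=> [y [v Vv [b]]|x /= xt].
  rewrite unit_ballE/= => b1 <-; apply: (le_trans (nP _ _ Vv)).
  by rewrite addrAC subrr add0r sqnormZ ler_piMr ?sqr_ge0.
exists (P x) => //; move: t0; rewrite le_eqVlt => /predU1P[t0|t0].
  exists 0; first by rewrite unit_ballE/= -(scale0r 0) sqnormZ expr0n mul0r.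
  move: xt; rewrite -t0 expr0n/= => /sqnorm_eq0 /eqP.
  by rewrite scaler0 addr0 subr_eq0 => /eqP.
exists (t^-1 *: (x - P x)); last by rewrite scalerA divff ?gt_eqF// scale1r subrKC.
rewrite unit_ballE/= sqnormZ exprVn mulrC ler_pdivrMr ?mul1r//.
exact: exprn_gt0.
Qed.

Lemma sqnorm_lr n (z : 'rV[R]_(n + 1)) :
  sqnorm z = sqnorm (lsubmx z) + z ord0 (rshift n ord0) ^+ 2.
Proof.
rewrite /sqnorm big_split_ord/= big_ord1; congr (_ + _).
by apply: eq_bigr => i _; rewrite mxE.
Qed.

(** The nearest point of V x 0 to (x, y) is (P x, 0), and the squared distance gains the term
    y^2. *)
Lemma dilation_squeezed n (V : set 'rV[R]_n) (P : 'rV[R]_n -> 'rV[R]_n) t :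
  0 <= t -> (forall x, V (P x)) ->
  (forall x v, V v -> sqnorm (x - P x) <= sqnorm (x - v)) ->
  dilation (squeezed_cylinder V) t = [set z |
    sqnorm (lsubmx z - P (lsubmx z)) + z ord0 (rshift n ord0) ^+ 2 <= t ^+ 2].
Proof.
move=> t0 VP nP.
have E (z : 'rV[R]_(n + 1)) (v : 'rV[R]_n) : sqnorm (z - row_mx v 0) =
    sqnorm (lsubmx z - v) + z ord0 (rshift n ord0) ^+ 2.
  rewrite sqnorm_lr mxE [(- row_mx _ _) _ _]mxE row_mxEr mxE subr0; congr (sqnorm _ + _).
  by apply/rowP => i; rewrite mxE mxE [(- row_mx _ _) _ _]mxE row_mxEl !mxE.
rewrite (@dilationE _ _ (fun z => row_mx (P (lsubmx z)) 0))//.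
- by apply/seteqP; split=> z /=; rewrite E.
- by move=> z; exists (P (lsubmx z)).
- by move=> z _ [v Vv <-]; rewrite !E lerD2r nP.
Qed.

Lemma sqnorm_lin n (x y : 'rV[R]_n) a s : sqnorm (a *: y - s *: x) =
  a ^+ 2 * sqnorm y - 2 * a * s * (\sum_i x ord0 i * y ord0 i) + s ^+ 2 * sqnorm x.
Proof.
rewrite /sqnorm !mulr_sumr -sumrB -big_split/=.
by apply: eq_bigr => i _; rewrite !mxE; ring.
Qed.

(** Expand the squared norm of |x|^2 y - <x, y> x and divide by |x|^2. *)
Lemma cauchy_schwarz n (x y : 'rV[R]_n) :
  (\sum_i x ord0 i * y ord0 i) ^+ 2 <= sqnorm x * sqnorm y.
Proof.
have [->|x0] := eqVneq x 0.
  rewrite big1 => [|i _]; last by rewrite mxE mul0r.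
  by rewrite expr0n mulr_ge0 ?sqnorm_ge0.
have {}x0 : 0 < sqnorm x.
  by rewrite lt_neqAle sqnorm_ge0 andbT eq_sym; apply: contra_neq x0 => H;
    apply: sqnorm_eq0; rewrite H.
pose s := \sum_i x ord0 i * y ord0 i.
have := sqnorm_ge0 (sqnorm x *: y - s *: x).
have -> : sqnorm (sqnorm x *: y - s *: x) =
    sqnorm x * (sqnorm x * sqnorm y - s ^+ 2).
  by rewrite sqnorm_lin -/s; ring.
by rewrite pmulr_rge0// subr_ge0.
Qed.

Lemma reverse_triangle n (x y : 'rV[R]_n) :
  (Num.sqrt (sqnorm x) - Num.sqrt (sqnorm y)) ^+ 2 <= sqnorm (x - y).
Proof.
have -> : sqnorm (x - y) =
    sqnorm x - 2 * (\sum_i y ord0 i * x ord0 i) + sqnorm y.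
  by rewrite -[x]scale1r -[y]scale1r sqnorm_lin !scale1r; ring.
rewrite sqrrB !sqr_sqrtr ?sqnorm_ge0// lerD2r lerD2l lerN2 -(mulr_natl (_ * _)) ler_wpM2l//.
rewrite -sqrtrM ?sqnorm_ge0//.
by rewrite mulrC (le_trans (ler_norm _))// -sqrtr_sqr ler_wsqrtr// cauchy_schwarz.
Qed.

(** The maximum with 1 covers both cases: points of the ball are fixed, the others normalised. *)
Definition ball_proj n (x : 'rV[R]_n) : 'rV[R]_n :=
  (Num.max 1 (Num.sqrt (sqnorm x)))^-1 *: x.

Lemma sqnorm_ball_proj n (x : 'rV[R]_n) :
  sqnorm (x - ball_proj x) = Num.max 0 (Num.sqrt (sqnorm x) - 1) ^+ 2.
Proof.
rewrite /ball_proj -[x in x - _]scale1r -scalerBl sqnormZ.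
rewrite -[X in _ * X](sqr_sqrtr (sqnorm_ge0 x)) -exprMn.
set s := Num.sqrt _; have [s1|s1] := leP s 1.
  by rewrite invr1 subrr mul0r max_l// subr_le0.
rewrite max_r ?subr_ge0 1?ltW//; congr (_ ^+ 2).
by field; rewrite gt_eqF// (lt_trans _ s1).
Qed.

Lemma unit_ball_proj n (x : 'rV[R]_n) : unit_ball R n (ball_proj x).
Proof.
rewrite unit_ballE/= /ball_proj sqnormZ -[X in _ * X](sqr_sqrtr (sqnorm_ge0 x)).
set s := Num.sqrt _; have s0 : 0 <= s by exact: sqrtr_ge0.
rewrite -exprMn expr_le1// ?mulr_ge0 ?invr_ge0 ?le_max ?ler01//.
by rewrite mulrC ler_pdivrMr ?mul1r ?le_max ?lexx ?orbT// lt_max ltr01.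
Qed.

(** For |x| > 1 >= |v|, the chain is |x| - 1 <= |x| - |v| <= |x - v|. *)
Lemma ball_proj_nearest n (x v : 'rV[R]_n) : unit_ball R n v ->
  sqnorm (x - ball_proj x) <= sqnorm (x - v).
Proof.
rewrite unit_ballE/= => v1; rewrite sqnorm_ball_proj.
apply: (le_trans _ (reverse_triangle x v)).
have v1' : Num.sqrt (sqnorm v) <= 1 by rewrite -[leRHS]sqrtr1 ler_wsqrtr.
have := sqrtr_ge0 (sqnorm v); move: (Num.sqrt (sqnorm v)) v1' => a a1 a0.
have [|s1] := leP (Num.sqrt (sqnorm x) - 1) 0.
  by rewrite expr0n sqr_ge0.
by rewrite lerXn2r ?nnegrE//; lra.
Qed.

Definition cube_proj n (x : 'rV[R]_n) : 'rV[R]_n :=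
  \row_i Num.max (-1) (Num.min 1 (x ord0 i)).

Lemma unit_cubeP n (x : 'rV[R]_n) :
  unit_cube R n x <-> forall i, `|x ord0 i| <= 1.
Proof.
split=> [x1 i|x1]; last by apply: bigmax_le.
by apply: le_trans x1; exact: (le_bigmax _ (fun i => `|x ord0 i|)).
Qed.

Lemma sqnorm_cube_proj n (x : 'rV[R]_n) :
  sqnorm (x - cube_proj x) = \sum_(i < n) coord_dist true (x ord0 i) ^+ 2.
Proof.
apply: eq_bigr => i _; rewrite !mxE /coord_dist; move: (x _ _) => y.
have [y1|y1] := ltP 1 y.
  by rewrite max_r ?gtr0_norm ?max_r//; lra.
have [y2|y2] := ltP y (-1).
  by rewrite ler0_norm ?max_r; [ring|lra..].
by rewrite subrr max_l// subr_le0 ler_norml y2.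
Qed.

Lemma unit_cube_proj n (x : 'rV[R]_n) : unit_cube R n (cube_proj x).
Proof.
apply/unit_cubeP => i; rewrite mxE ler_norml le_max lexx ge_max ge_min lexx/= andbT; lra.
Qed.

Lemma cube_proj_nearest n (x v : 'rV[R]_n) : unit_cube R n v ->
  sqnorm (x - cube_proj x) <= sqnorm (x - v).
Proof.
move=> /unit_cubeP v1; rewrite sqnorm_cube_proj; apply: ler_sum => i _.
rewrite !mxE -[leRHS]real_normK ?num_real// lerXn2r ?nnegrE ?coord_dist_ge0//.
rewrite /coord_dist ge_max normr_ge0/=.
apply: (le_trans _ (lerB_dist _ _)); first by rewrite lerD2l lerN2.
Qed.

(** * The four Steiner polynomials in closed form *)

Local Notation c := (@circle_moment R).

Lemma coef_semicircle_op p k :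
  (semicircle_op p)`_k = if k is k'.+1 then p`_k' * c k' else 0.
Proof.
rewrite /semicircle_op coefXM; case: k => //= k; rewrite coef_poly.
by case: ltnP => // /leq_sizeP -> //; rewrite mul0r.
Qed.

Lemma coord_poly_false n :
  coord_poly false n = (\prod_(j < n) c j) *: 'X^n.
Proof.
elim: n => [|n IH]; first by rewrite big_ord0 scale1r.
rewrite /coord_poly iterS -/(coord_poly _ _) IH /slice_op add0r.
apply/polyP => -[|k]; rewrite coef_semicircle_op !coefZ !coefXn ?mulr0// eqSS.
rewrite big_ord_recr/=; case: eqP => [->|_]; last by rewrite !mulr0 mul0r.
by rewrite !mulr1.
Qed.

(** Applying 2 + T adds the coefficients as in Pascal's rule: T turns K_k into K_(k+1) = K_k c_k and
    raises the degree by one. *)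
Lemma coord_poly_true n : coord_poly true n =
  \poly_(k < n.+1) ('C(n, k)%:R * (2 ^+ (n - k) * \prod_(j < k) c j)).
Proof.
elim: n => [|n IH].
  apply/polyP => k; rewrite coef_poly coef1 ltnS leqn0.
  by case: eqP => // ->; rewrite bin0 subn0 big_ord0 !mulr1.
rewrite /coord_poly iterS -/(coord_poly _ _) IH /slice_op.
apply/polyP => k; rewrite coefD coefZ coef_semicircle_op !coef_poly !ltnS.
case: k => [|k]; first by rewrite !bin0 !subn0 big_ord0 exprS /= ?leq0n; ring.
rewrite coef_poly binS natrD subSS big_ord_recr/= !ltnS.
case: (ltngtP k n) => [kn|nk|->].
- by rewrite -(subnSK kn) exprS; ring.
- by rewrite mulr0 mul0r addr0.
- by rewrite (bin_small (ltnSn n)); ring.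
Qed.

Lemma steiner_polyE n (V : set 'rV[R]_n) (S : {poly R}) :
  is_steiner_poly V S -> steiner_poly V = S.
Proof.
move=> VS; apply: xget_subset1 => // P Q; exact: is_steiner_poly_unique.
Qed.

(** Being within r of the unit ball means having norm at most 1 + r. *)
Lemma vol_ball_proj n r : 0 <= r ->
  vol [set x : 'rV[R]_n | sqnorm (x - ball_proj x) <= r ^+ 2] =
  (((\prod_(j < n) c j) *: (1 + 'X) ^+ n).[r])%:E.
Proof.
move=> r0; rewrite (_ : mkset _ = [set x : 'rV[R]_n |
    \sum_(i < n) coord_dist false (x ord0 i) ^+ 2 <= (1 + r) ^+ 2]).
  rewrite vol_coord ?addr_ge0// coord_poly_false !hornerZ hornerXn.
  by rewrite horner_exp !hornerE.
apply/funext => x /=; congr is_true; rewrite sqnorm_ball_proj.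
under [in RHS]eq_bigr do rewrite real_normK ?num_real//.
rewrite -/(sqnorm x) -[in RHS](sqr_sqrtr (sqnorm_ge0 x)).
rewrite !ler_pXn2r// ?nnegrE ?addr_ge0 ?sqrtr_ge0 ?le_max ?lexx//.
by rewrite ge_max r0/= lerBlDl.
Qed.

Lemma steiner_ball n :
  steiner_poly (unit_ball R n) = (\prod_(j < n) c j) *: (1 + 'X) ^+ n.
Proof.
apply: steiner_polyE => t t0.
rewrite (dilationE t0 (@unit_ball_proj n) (@ball_proj_nearest n)).
exact: vol_ball_proj.
Qed.

Lemma measurable_sqnorm n : measurable_fun [set: n.-tuple (measurableTypeR R)]
  (fun t : n.-tuple (measurableTypeR R) => sqnorm (\row_i (tnth t i : R))).
Proof.
rewrite /sqnorm; apply: measurable_sum => i; under eq_fun do rewrite mxE.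
by apply: measurable_funX; exact: measurable_tnth.
Qed.

(** The slice at height y is the parallel body of the base at distance sqrt(t^2 - y^2), so squeezing
    applies T to the volume polynomial. *)
Lemma vol_squeezed n (phi : 'rV[R]_n -> R) p t : 0 <= t ->
  measurable_fun [set: n.-tuple (measurableTypeR R)]
    (fun t : n.-tuple (measurableTypeR R) => phi (\row_i (tnth t i : R))) ->
  (forall x, 0 <= phi x) ->
  (forall r, 0 <= r -> vol [set x | phi x <= r ^+ 2] = (p.[r])%:E) ->
  vol [set z : 'rV[R]_(n + 1) | phi (lsubmx z) + z ord0 (rshift n ord0) ^+ 2 <= t ^+ 2] =
  ((semicircle_op p).[t])%:E.
Proof.
move=> t0 mphi phi0 vphi; rewrite (@vol_slice1 _ n phi (fun y => y ^+ 2))//.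
rewrite (@integral_slices _ false p t)//= ?add0r//.
- by rewrite /slice_op add0r.
- move=> y yt; rewrite -vphi ?sqrtr_ge0// sqr_sqrtr; last first.
    by rewrite subr_ge0 lerXn2r ?nnegrE.
  by congr vol; apply/funext => x /=; rewrite lerBrDr real_normK ?num_real.
- move=> y ty; rewrite (_ : mkset _ = set0) /vol ?measure0//.
  apply/seteqP; split=> // x /=; apply/negP; rewrite -ltNge.
  rewrite (@lt_le_trans _ _ (y ^+ 2))// ?lerDr//.
  by rewrite -[ltRHS]real_normK ?num_real// ltrXn2r ?nnegrE.
Qed.

Lemma steiner_squeezed_ball n :
  steiner_poly (squeezed_cylinder (unit_ball R n)) =
  'X * ((\prod_(j < n) c j) *: \poly_(k < n.+1) ('C(n, k)%:R * c k)).
Proof.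
rewrite (_ : 'X * _ = semicircle_op ((\prod_(j < n) c j) *: (1 + 'X) ^+ n)).
  apply: steiner_polyE => t t0.
  rewrite (dilation_squeezed t0 (@unit_ball_proj n) (@ball_proj_nearest n)).
  apply: (vol_squeezed (phi := fun x => sqnorm (x - ball_proj x))) => //.
  - under eq_fun do rewrite sqnorm_ball_proj.
    apply: measurable_funX; apply: measurable_maxr => //.
    apply: measurable_funB => //.
    apply: (measurableT_comp (continuous_measurable_fun (@sqrt_continuous R))).
    exact: measurable_sqnorm.
  - by move=> x; exact: sqnorm_ge0.
  - by move=> r; exact: vol_ball_proj.
apply/polyP => k; rewrite coef_semicircle_op coefXM; case: k => //= k.
rewrite !coefZ coef_poly coef_add1Xn ltnS; case: leqP => nk; first by ring.
by rewrite bin_small// !mulr0 mul0r.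
Qed.

Lemma dilation_cube n t : 0 <= t ->
  dilation (unit_cube R n) t =
  [set x | \sum_(i < n) coord_dist true (x ord0 i) ^+ 2 <= t ^+ 2].
Proof.
move=> t0; rewrite (dilationE t0 (@unit_cube_proj n) (@cube_proj_nearest n)).
by apply/funext => x /=; rewrite sqnorm_cube_proj.
Qed.

Lemma steiner_cube n : steiner_poly (unit_cube R n) =
  \poly_(k < n.+1) ('C(n, k)%:R * (2 ^+ (n - k) * \prod_(j < k) c j)).
Proof.
rewrite -coord_poly_true; apply: steiner_polyE => t t0.
by rewrite dilation_cube// vol_coord.
Qed.

(** T contributes the factor c_k, which extends K_k to K_(k+1). *)
Lemma steiner_squeezed_cube n :
  steiner_poly (squeezed_cylinder (unit_cube R n)) =
  'X * \poly_(k < n.+1) ('C(n, k)%:R * (2 ^+ (n - k) * \prod_(j < k.+1) c j)).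
Proof.
rewrite (_ : 'X * _ = semicircle_op (coord_poly true n)).
  apply: steiner_polyE => t t0.
  rewrite (dilation_squeezed t0 (@unit_cube_proj n) (@cube_proj_nearest n)).
  apply: (vol_squeezed (phi := fun x => sqnorm (x - cube_proj x))) => //.
  - under eq_fun do rewrite sqnorm_cube_proj.
    exact: measurable_coord_sum.
  - by move=> x; exact: sqnorm_ge0.
  - move=> r r0; rewrite -vol_coord//; congr vol.
    by apply/funext => x /=; rewrite sqnorm_cube_proj.
rewrite coord_poly_true.
apply/polyP => k; rewrite coef_semicircle_op coefXM; case: k => //= k.
rewrite !coef_poly big_ord_recr/=; case: ifP => _; last by rewrite mul0r.
by rewrite !mulrA.
Qed.

End dilations.

Lemma deriv_sub1X_mul (R : comNzRingType) (p : {poly R}) :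
  ((1 - 'X) * p)^`() = (1 - 'X) * p^`() - p.
Proof. by rewrite derivM derivB derivC derivX sub0r mulN1r addrC. Qed.

(** The coefficients are integer combinations of those of p, so this operator commutes with taking
    real parts coefficientwise. *)
Lemma coef_sub_deriv (R : comNzRingType) (p : {poly R}) k :
  (p - (1 - 'X) * p^`())`_k = (p`_k - p`_k.+1) *+ k.+1.
Proof.
rewrite mulrBl mul1r !coefB coefXM !coef_deriv; case: k => [|k] /=.
  by rewrite subr0.
by rewrite mulrnBl !mulrSr; ring.
Qed.

Lemma coef_add1ZXn (R : comNzRingType) (z : R) n k :
  ((1 + z *: 'X) ^+ n)`_k = 'C(n, k)%:R * z ^+ k.
Proof.
have -> : (1 + z *: 'X) ^+ n = (1 + 'X) ^+ n \Po (z *: 'X).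
  by rewrite rmorphXn rmorphD/= comp_polyX rmorph1.
by rewrite coef_comp_scale coef_add1Xn.
Qed.

(** * The squeezed ball *)

Section dissipativity.
Context {R : realType}.
Implicit Types (z u : R[i]).
Local Notation Re := (@complex.Re R).
Local Notation c := (@circle_moment R).

Lemma ReD z u : Re (z + u) = Re z + Re u.
Proof. by case: z u => [a b] [a' b']. Qed.

Lemma ReB z u : Re (z - u) = Re z - Re u.
Proof. by case: z u => [a b] [a' b']. Qed.

Lemma ReMr z (x : R) : Re (z * x%:C%C) = Re z * x.
Proof. by case: z => [a b] /=; rewrite mulr0 subr0. Qed.

Lemma ReMn z n : Re (z *+ n) = Re z *+ n.
Proof. by elim: n => [|n IH]; rewrite ?mulr0n// !mulrS ReD IH. Qed.

Lemma Re_sum n (F : 'I_n -> R[i]) : Re (\sum_i F i) = \sum_i Re (F i).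
Proof. by apply: (big_morph Re) => // z u; exact: ReD. Qed.

Lemma Re_lt1 u : `|u| < 1 -> Re u < 1.
Proof.
move=> u1; have := le_lt_trans (normc_ge_Re u) u1.
by rewrite (ltcR _ 1); apply: le_lt_trans; exact: ler_norm.
Qed.

(** Both coordinates of 1 + z x are dominated by those of 1 + z; strictness comes from the imaginary
    part if Re z = 0, and from the real part otherwise. *)
Lemma norm_add1M_lt z (x : R) : 0 <= Re z -> z != 0 -> 0 <= x < 1 ->
  `|1 + z * x%:C%C| < `|1 + z|.
Proof.
case: z => [a b] /= a0; rewrite eq_complex/= negb_and => ab /andP[x0 x1].
rewrite !normc_def ltcR ltr_sqrt/= ?mulr0 ?subr0 ?add0r.
  have ax : (1 + a * x) ^+ 2 <= (1 + a) ^+ 2 by rewrite lerXn2r ?nnegrE//; nra.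
  have bx : (b * x) ^+ 2 <= b ^+ 2.
    by rewrite exprMn ler_piMr ?sqr_ge0// exprn_ile1// ltW.
  have [a1|a1] := eqVneq a 0.
    have {}ab : b != 0 by move: ab; rewrite a1 eqxx.
    apply: ler_ltD => //; rewrite exprMn gtr_pMr ?exprn_ilt1//.
    by rewrite exprn_even_gt0.
  have a2 : 0 < a by rewrite lt_neqAle eq_sym a1.
  apply: ltr_leD => //; rewrite -subr_gt0.
  have -> : (1 + a) ^+ 2 - (1 + a * x) ^+ 2 = a * (1 - x) * (2 + a + a * x) by ring.
  by rewrite !mulr_gt0 ?subr_gt0//; nra.
nra.
Qed.

(* With rho = (1 + zX)/(1 + z), the real part of the complex polynomial
   (z/(1+z)) * (1 + rho + ... + rho^n) = (1 - rho^(n+1))/(1 - X) is positive on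
   [0, 1], and [Rintegral_deriv_gt0] applies to it: the derivative of rho^(n+1)
   is a multiple of (1 + zX)^n. *)
Lemma dissipative_moments n :
  dissipative (complexify (\poly_(k < n.+1) ('C(n, k)%:R * c k))).
Proof.
move=> z rz; rewrite ltNge; apply/negP => z0.
have Dz : \sum_(k < n.+1) ('C(n, k)%:R * c k)%:C%C * z ^+ k = 0.
  move/eqP : rz => rz; apply: etrans rz; rewrite /complexify.
  rewrite (@horner_coef_wide _ n.+1); last by rewrite size_map_poly size_poly.
  by apply: eq_bigr => k _; rewrite coef_map/= coef_poly ltn_ord.
have zn0 : z != 0.
  apply/eqP => zE; move: Dz; rewrite zE big_ord_recl big1 => [|i _]; last first.
    by rewrite exprS mul0r mulr0.
  rewrite expr0 mulr1 addr0 bin0 mul1r -(rmorph0 (real_complex R)).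
  by move=> /complexI/eqP; rewrite gt_eqF// circle_moment_gt0.
pose w := 1 + z.
have w0 : w != 0.
  by rewrite -normr_gt0; apply: le_lt_trans (@norm_add1M_lt z 0 z0 zn0 _); rewrite // lexx ltr01.
pose rho : {poly R[i]} := w^-1 *: (1 + z *: 'X).
pose gC : {poly R[i]} := (z / w) *: \sum_(j < n.+1) rho ^+ j.
have gCE : (1 - 'X) * gC = 1 - rho ^+ n.+1.
  have -> : 1 - rho ^+ n.+1 = (1 - rho) * \sum_(j < n.+1) rho ^+ j.
    by rewrite -[in LHS](expr1n _ n.+1) subrXX; congr (_ * _);
      apply: eq_bigr => i _; rewrite expr1n mul1r.
  rewrite /gC -scalerAr scalerAl; congr (_ * _).
  have -> : 1 - rho = (1 - w^-1) *: 1 - (w^-1 * z) *: 'X.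
    by rewrite /rho scalerDr scalerA scalerBl scale1r opprD addrA.
  have -> : 1 - w^-1 = z / w by rewrite /w; field.
  by rewrite [w^-1 * z]mulrC scalerBr.
have sizegC : (size gC <= n.+1)%N.
  rewrite (leq_trans (size_scale_leq _ _))// (leq_trans (size_sum _ _ _))//.
  apply/bigmax_leqP => j _; rewrite (leq_trans (size_poly_exp_leq _ _))//.
  have : (size rho <= 2)%N.
    rewrite (leq_trans (size_scale_leq _ _))// (leq_trans (size_polyD _ _))//.
    by rewrite size_poly1 geq_max/= (leq_trans (size_scale_leq _ _))// size_polyX.
  by have := ltn_ord j; nia.
pose g : {poly R} := \poly_(k < n.+1) Re gC`_k.
have gk k : g`_k = Re gC`_k.
  rewrite coef_poly ltnS; case: leqP => // nk.
  by rewrite nth_default// (leq_trans sizegC).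
have gx x : g.[x] = Re gC.[x%:C%C].
  rewrite horner_poly (horner_coef_wide _ sizegC) Re_sum; apply: eq_bigr => k _.
  by rewrite -rmorphXn ReMr.
have rhox x : rho.[x%:C%C] = (1 + z * x%:C%C) / w.
  by rewrite !hornerE mulrC.
have g0 x : 0 <= x <= 1 -> 0 < g.[x].
  rewrite gx => /andP[x0]; rewrite le_eqVlt => /predU1P[->|x1].
    have -> : gC.[1%:C%C] = (1 - w^-1) * (n.+1%:R)%:C%C.
      rewrite hornerZ horner_sum; congr (_ * _); first by rewrite /w; field.
      under eq_bigr do rewrite horner_exp rhox mulr1 divff// expr1n.
      by rewrite sumr_const card_ord rmorph_nat.
    rewrite ReMr mulr_gt0 ?ltr0n// ReB subr_gt0 Re_lt1//.
    have := @norm_add1M_lt z 0 z0 zn0; rewrite lexx ltr01 mulr0 addr0 => /(_ isT).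
    by rewrite normrV ?unitfE// invf_lt1 ?normr_gt0// normr1.
  have x1' : 0 < 1 - x by rewrite subr_gt0.
  rewrite -(pmulr_lgt0 _ x1') -ReMr rmorphB rmorph1.
  have -> : gC.[x%:C%C] * (1 - x%:C%C) = ((1 - 'X) * gC).[x%:C%C].
    by rewrite hornerM hornerD hornerN hornerC hornerX mulrC.
  rewrite gCE hornerD hornerN hornerC horner_exp rhox ReB subr_gt0 Re_lt1//.
  rewrite normrX exprn_ilt1 ?normr_ge0// normf_div ltr_pdivrMr ?normr_gt0// mul1r.
  by rewrite norm_add1M_lt// x0.
have := Rintegral_deriv_gt0 g0.
pose A := n.+1%:R * (z / w) / w ^+ n.
have qk k : (g - (1 - 'X) * g^`())`_k = Re (A * 'C(n, k)%:R * z ^+ k).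
  have : (gC - (1 - 'X) * gC^`())`_k = A * 'C(n, k)%:R * z ^+ k.
    have -> : gC - (1 - 'X) * gC^`() = (rho ^+ n.+1)^`().
      have := deriv_sub1X_mul gC; rewrite gCE derivB derivC sub0r => H.
      by rewrite -[RHS]opprK H opprB.
    rewrite deriv_exp /rho derivZ derivD derivC derivZ derivX add0r /=.
    rewrite exprZn -scalerAr coefMn coefZ -scalerAl coefZ -scalerAl coefZ mul1r.
    rewrite coef_add1ZXn -(mulr_natl (w^-1 ^+ n * _)) /A exprVn; field.
    by rewrite ?expf_neq0.
  rewrite !coef_sub_deriv !gk -ReB => <-.
  by rewrite ReMn.
rewrite (@Rintegral_horner_semicircle _ n.+1); last first.
  apply/leq_sizeP => k nk; rewrite qk bin_small// mulr0 mul0r//.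
rewrite (_ : \sum_(k < n.+1) _ =
  Re (A * \sum_(k < n.+1) ('C(n, k)%:R * c k)%:C%C * z ^+ k)).
  by rewrite Dz mulr0 ltxx.
rewrite mulr_sumr Re_sum; apply: eq_bigr => k _; rewrite qk -ReMr.
by rewrite rmorphM rmorph_nat; congr Re; ring.
Qed.

Lemma nonreal_moments n : (2 <= n)%N ->
  exists z : R[i],
    root (complexify (\poly_(k < n.+1) ('C(n, k)%:R * c k))) z /\
    z \isn't Num.real.
Proof.
move=> n2; apply: contrapT => H.
set D := \poly_(k < n.+1) _ in H.
have Dk k : (k <= n)%N -> (complexify D)`_k = ('C(n, k)%:R * c k)%:C%C.
  by move=> kn; rewrite coef_complexify coef_poly ltnS kn.
have := @newton_low _ (complexify D) n.
rewrite !Dk ?(ltnW n2)// bin0 bin1 mul1r => N.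
have {N} : (2 * n)%:R * (c 0)%:C%C * ('C(n, 2)%:R * c 2)%:C%C <=
    n.-1%:R * (n%:R * c 1)%:C%C ^+ 2 :> R[i].
  apply: N.
  - by rewrite size_map_poly size_poly.
  - by rewrite fmorph_eq0 gt_eqF// circle_moment_gt0.
  - by rewrite complex_real.
  - move=> z rz; apply: contrapT => zR; apply: H; exists z; split=> //.
    exact/negP.
rewrite -!(rmorph_nat (real_complex R)) -rmorphXn -!rmorphM/= lecR; apply/negP.
rewrite -ltNge exprMn.
have -> : n.-1%:R * (n%:R ^+ 2 * c 1 ^+ 2) = (n.-1%:R * n%:R ^+ 2) * c 1 ^+ 2 by ring.
have -> : (2 * n)%:R * c 0 * ('C(n, 2)%:R * c 2) = (n.-1%:R * n%:R ^+ 2) * (c 0 * c 2).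
  have -> : (2 * n)%:R * c 0 * ('C(n, 2)%:R * c 2) = (n%:R * ('C(n, 2) * 2)%:R) * (c 0 * c 2).
    by rewrite !natrM; ring.
  by rewrite mulnC -mul_bin_diag bin1 natrM; ring.
rewrite ltr_pM2l ?circle_moment_lt// mulr_gt0 ?exprn_gt0 ?ltr0n//; lia.
Qed.

End dissipativity.

Lemma negative_roots_dissipative (R : realType) (p : {poly R[i]}) :
  negative_roots p -> dissipative p.
Proof. by move=> pn z /pn; rewrite ltcE => /andP[]. Qed.

Theorem theorem2p8 (R : realType) :
  [/\ forall n : nat, (0 < n)%N ->
        dissipative (complexify (steiner_poly (unit_ball R n))) /\
        negative_roots (complexify (steiner_poly (unit_ball R n))),
      (forall n : nat, (0 < n)%N ->
        exists D : {poly R},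
          steiner_poly (squeezed_cylinder (unit_ball R n)) = 'X * D /\
          dissipative (complexify D)) /\
      (exists N : nat, forall n : nat, (N <= n)%N ->
        exists z : R[i],
          root (complexify (steiner_poly (squeezed_cylinder (unit_ball R n)))) z
          /\ z \isn't Num.real),
      forall n : nat, (0 < n)%N ->
        dissipative (complexify (steiner_poly (unit_cube R n))) /\
        negative_roots (complexify (steiner_poly (unit_cube R n))) &
      forall n : nat, (0 < n)%N ->
        exists D : {poly R},
          [/\ steiner_poly (squeezed_cylinder (unit_cube R n)) = 'X * D,
              dissipative (complexify D) & negative_roots (complexify D)]].
Proof.
have K0 n : \prod_(j < n) @circle_moment R j != 0.
  by rewrite gt_eqF// prodr_gt0// => j _; exact: circle_moment_gt0.
have rootK n (p : {poly R}) z :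
    root (complexify ((\prod_(j < n) @circle_moment R j) *: p)) z = root (complexify p) z.
  by rewrite /complexify map_polyZ rootZ ?fmorph_eq0.
have wallis n s := @negative_roots_wallis R _ (@circle_moment_gt0 R)
  (@circle_moment_noninc R) (@circle_moment_rec R) n s.
split.
- move=> n n0; rewrite steiner_ball.
  suff H : negative_roots (complexify
      ((\prod_(j < n) @circle_moment R j) *: (1 + 'X) ^+ n)).
    by split=> //; exact: negative_roots_dissipative.
  by move=> z; rewrite rootK; exact: negative_roots_add1Xn.
- split=> [n n0|].
    eexists; split; first exact: steiner_squeezed_ball.
    by move=> z; rewrite rootK; exact: dissipative_moments.
  exists 2%N => n n2; have [z [rz zR]] := @nonreal_moments R n n2.
  exists z; split=> //; rewrite steiner_squeezed_ball /complexify rmorphM/= rootM.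
  by rewrite [X in _ || X]rootK rz orbT.
- move=> n n0; rewrite steiner_cube.
  suff H : negative_roots (complexify (\poly_(k < n.+1)
      ('C(n, k)%:R * (2 ^+ (n - k) * \prod_(j < k) @circle_moment R j)))).
    by split=> //; exact: negative_roots_dissipative.
  have := wallis n 0%N.
  by rewrite (_ : \poly_(k < _) _ = \poly_(k < n.+1)
    ('C(n, k)%:R * (2 ^+ (n - k) * \prod_(j < k) @circle_moment R j)))//;
    apply/polyP => k; rewrite !coef_poly addn0.
- move=> n n0; eexists; rewrite steiner_squeezed_cube; split; first by [].
  all: have := wallis n 1%N.
  all: rewrite (_ : \poly_(k < _) _ = \poly_(k < n.+1)
    ('C(n, k)%:R * (2 ^+ (n - k) * \prod_(j < k.+1) @circle_moment R j)));
    last by apply/polyP => k; rewrite !coef_poly addn1.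
  + exact: negative_roots_dissipative.
  + by [].
Qed.
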